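(* Let $N$ be a locally compact subset of a smooth manifold $M$. Assume that for each two points $x, y \in N$ there exist neighborhoods $Ux$ of $x$ and $Uy$ of $y$ in $M$ and a diffeomorphism $h : Ux \to Uy$ such that $h(x) = y$ and $h(Ux \cap N) = Uy \cap N$. Then $N$ is a smooth submanifold of $M$.
   Context: Throughout, ''smooth'' means ''differentiable'' (not necessarily continuously differentiable). Thus a smooth manifold $M$ (of dimension $m$, Hausdorff, second countable) is one whose transition maps are differentiable, and a diffeomorphism is a bijection that is differentiable and whose inverse is differentiable. Neighborhoods $Ux$, $Uy$ are open subsets of $M$. The subset $N$ is locally compact in the subspace topology induced from $M$. $N$ is a smooth submanifold of $M$ if there is an integer $k$ with $0 \le k \le m$ such that every point of $N$ has an open neighborhood $U$ in $M$ and a diffeomorphism $\varphi$ (i.e. a differentiable bijection whose inverse is differentiable) from $U$ onto an open subset of $\mathbb{R}^m$ with $\varphi(U \cap N) = \varphi(U) \cap (\mathbb{R}^k \times \{0\})$. No boundary is allowed, and $N$ is not required to be closed in $M$. *)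

(* Defs.v *)
From HB Require Import structures.
From mathcomp Require Import all_boot all_order all_algebra.
From mathcomp Require Import all_classical all_reals all_analysis.
Import Order.TTheory GRing.Theory Num.Theory.
Import numFieldNormedType.Exports.

Set Implicit Arguments.
Unset Strict Implicit.
Unset Printing Implicit Defensive.

Local Open Scope classical_set_scope.
Local Open Scope ring_scope.

(** "Smooth" means differentiable (not necessarily C^1) throughout.

    A map defined on an open set is encoded by a total function, whose values
    outside that set are irrelevant: continuity and differentiability at a
    point depend only on the germ of the function there. *)

Record chart (R : realType) (m : nat) (T : topologicalType) := Chart {
  chart_dom : set T ;
  chart_fun :> T -> 'rV[R]_m ;
  chart_inv : 'rV[R]_m -> T ;
  chart_dom_open : open chart_dom ;
  chart_codom_open : open (chart_fun @` chart_dom) ;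
  chart_funK : {in chart_dom, cancel chart_fun chart_inv} ;
  chart_fun_continuous : {in chart_dom, continuous chart_fun} ;
  chart_inv_continuous : {in chart_fun @` chart_dom, continuous chart_inv}
}.

(** Atlases are not required to be maximal; the notions below take the same
    value on an atlas and on the maximal atlas containing it. *)
Record atlas (R : realType) (m : nat) (T : topologicalType) := Atlas {
  charts : set (chart R m T) ;
  charts_cover : forall x, exists2 c, charts c & chart_dom c x ;
  charts_compatible : forall c d, charts c -> charts d ->
    forall x, chart_dom c x -> chart_dom d x ->
      differentiable (d \o chart_inv c) (c x)
}.

Record smooth_manifold (R : realType) (m : nat) := SmoothManifold {
  manifold_space :> topologicalType ;
  manifold_hausdorff : hausdorff_space manifold_space ;
  manifold_second_countable : @second_countable manifold_space ;
  manifold_atlas : atlas R m manifold_space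
}.

Section Euclidean.
Variables (R : realType) (m : nat).

Program Definition euclidean_chart : chart R m 'rV[R]_m :=
  @Chart R m 'rV[R]_m setT id id _ _ _ _ _.
Next Obligation. exact: openT. Qed.
Next Obligation. by rewrite image_id; exact: openT. Qed.
Next Obligation. by []. Qed.
Next Obligation. by move=> x _; exact: cvg_id. Qed.
Next Obligation. by move=> x _; exact: cvg_id. Qed.

Lemma euclidean_charts_compatible (c d : chart R m 'rV[R]_m) :
  [set euclidean_chart] c -> [set euclidean_chart] d ->
  forall x, chart_dom c x -> chart_dom d x ->
    differentiable (d \o chart_inv c) (c x).
Proof. by move=> -> -> x _ _; exact: (@ex_diff _ _ _ _ _ id id). Qed.

Program Definition euclidean_atlas : atlas R m 'rV[R]_m :=
  @Atlas R m 'rV[R]_m [set euclidean_chart] _ euclidean_charts_compatible.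
Next Obligation. by exists euclidean_chart. Qed.

End Euclidean.

Section Smooth.
Variables (R : realType) (m n : nat) (S T : topologicalType).
Variables (A : atlas R m S) (B : atlas R n T).

(** Continuity makes [d \o f \o chart_inv c] a genuine local representative:
    near [c x], the point [f (chart_inv c v)] stays in the domain of [d]. *)
Definition smooth_at (f : S -> T) (x : S) :=
  {for x, continuous f} /\
  forall c d, charts A c -> charts B d -> chart_dom c x -> chart_dom d (f x) ->
    differentiable (d \o f \o chart_inv c) (c x).

Definition smooth_on (U : set S) (f : S -> T) :=
  forall x, U x -> smooth_at f x.

End Smooth.

Definition diffeomorphism (R : realType) (m n : nat) (S T : topologicalType)
    (A : atlas R m S) (B : atlas R n T) (U : set S) (V : set T) (f : S -> T) :=
  [/\ open U, open V, set_bij U V f, smooth_on A B U f &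
      exists2 g : T -> S, {in U, cancel f g} & smooth_on B A V g].

(** The library's [locally_compact N], for [N] a set of points of [T], only
    asks that the points of [N] near a given one lie in a compact subset of
    [T], which does not have to be contained in [N] (the rationals satisfy it
    in the real line). Hence the passage to [N] as a space with its own
    (subspace) topology. *)
Definition locally_compact_subspace (T : topologicalType) (N : set T) :=
  locally_compact [set: set_type N].

(** The subspace R^k x {0} of R^m. *)
Definition coordinate_subspace (R : realType) (m k : nat) : set 'rV[R]_m :=
  [set v | forall i : 'I_m, (k <= i)%N -> v ord0 i = 0].

Definition smooth_submanifold (R : realType) (m : nat)
    (M : smooth_manifold R m) (N : set M) :=
  exists2 k : nat, (k <= m)%N &
    forall x, N x -> exists (U : set M) (phi : M -> 'rV[R]_m),
      [/\ U x,
          diffeomorphism (manifold_atlas M) (euclidean_atlas R m)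
            U (phi @` U) phi &
          phi @` (U `&` N) = phi @` U `&` @coordinate_subspace R m k].

(* Main.v *)
From HB Require Import structures.
Require Import Defs.
From mathcomp Require Import all_boot all_order all_algebra.
From mathcomp Require Import all_classical all_reals all_analysis.
From mathcomp Require Import measurable_realfun.
From mathcomp Require Import ring lra.
Import Order.TTheory GRing.Theory Num.Theory.
Import numFieldNormedType.Exports.

(** Let [T x] be the contingent cone of [N] at [x] in a chart: the limits of
    rescaled secants [z - x] with [z] in [N] tending to [x]. A derivative of a
    local diffeomorphism preserving [N] maps these cones onto each other.

    By a Baire argument due to Choquet, at some point of [N] every limit of
    secants [z - y] with [y] and [z] both tending to the point lies in the
    contingent cone. Transporting this by homogeneity, at every [x] the limits
    of [(z - y) / t] with [y - x = O(t)] lie in [T x]; in particular [T x] is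
    symmetric.

    Take the least [k] such that some piece of [N] is a Lipschitz graph over a
    subset of R^k. If this subset missed points near each of its points, then
    at a point of it nearest to a missed one, [T x] would avoid a half-line, by
    symmetry a line, and near the Choquet point [N] would be a Lipschitz graph
    over a subset of R^(k-1). So a piece of [N] is the graph of a Lipschitz map
    [F] over a ball of R^k. By Lebesgue's theorem and Fubini's, [F] has all its
    partial derivatives at some point; there the closure property of [T x] makes
    it a linear space of dimension [k]. By homogeneity all contingent cones are
    then linear, [F] is differentiable on the whole ball, and the shear by [F]
    straightens [N]. Homogeneity carries this chart to all points of [N]. *)

Set Implicit Arguments.
Unset Strict Implicit.
Unset Printing Implicit Defensive.

Local Open Scope classical_set_scope.
Local Open Scope ring_scope.

(** * Lipschitz functions of a real variable *)

Lemma lipschitz_continuous (R : realType) (V W : normedModType R) (f : V -> W)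
    (L : R) :
  0 <= L -> (forall x y, `|f x - f y| <= L * `|x - y|) -> continuous f.
Proof.
move=> L0 fL x; apply/(@cvgrPdist_le _ _ _ (nbhs x)) => e e0.
have L1 : 0 < L + 1 by rewrite ltr_wpDl.
apply/nbhs_ballP; exists (e / (L + 1)) => /=; first by rewrite divr_gt0.
move=> t; rewrite -ball_normE /= ltr_pdivlMr// => xt.
apply: (le_trans (fL _ _)); move: xt (normr_ge0 (x - t)); nra.
Qed.

Section LipschitzRealFunction.
Variables (R : realType) (g : R -> R) (L : R).
Hypothesis gL : forall x y, `|g x - g y| <= L * `|x - y|.

Let L0 : 0 <= L.
Proof.
have := gL 1 0; rewrite subr0 normr1 mulr1; apply: le_trans; exact: normr_ge0.
Qed.

(** Adding [L * x] makes a Lipschitz function nondecreasing, so that [G] has a Lebesgue-Stieltjes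
    measure and measure theory can supply its derivative. *)
Let G x := g x + L * x.

Let G_nd : nondecreasing G.
Proof.
move=> x y xy; rewrite /G; have := gL x y.
rewrite ler_norml => /andP[_]; rewrite ler0_norm ?subr_le0//; lra.
Qed.

Let G_cont : continuous G.
Proof.
move=> x; apply: cvgD; first exact: (@lipschitz_continuous R R R g L L0 gL).
by apply: cvgMr; exact: cvg_id.
Qed.

Let G_cumul : cumulative R R :=
  HB.pack G (isCumulative.Build R _ R G G_nd (right_continuousW G_cont)).

Let LS := lebesgue_stieltjes_measure G_cumul.

Local Open Scope ereal_scope.

Let wlength_G_le (I : set (ocitv_type R)) : measurable I ->
  wlength G_cumul I <= (2 * L)%:E * wlength idfun I.
Proof.
move=> /ocitvP[->|[[a b]/= ab ->]]; first by rewrite !wlength0 mule0.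
rewrite !wlength_itv_bnd ?(ltW ab)//= -EFinM lee_fin /G.
have := gL b a; rewrite (ger0_norm (_ : (0 <= b - a)%R)) ?subr_ge0 ?(ltW ab)//.
by rewrite ler_norml => /andP[_]; lra.
Qed.

(** The slopes of [G] are at most [2 * L], so a cover of small total length also has small total
    [G]-length. *)
Let LS_dominated (A : set (measurableTypeR R)) :
  lebesgue_measure A = 0 -> LS A = 0.
Proof.
move=> A0; apply/eqP; rewrite eq_le measure_ge0 andbT.
(* [2 * L + 1] instead of [2 * L] allows division when [L = 0]. *)
have L1 : (0 < 2 * L + 1)%R by rewrite ltr_wpDl// mulr_ge0.
apply/lee_addgt0Pr => e e0; rewrite add0e.
have d0 : (0 < e / (2 * L + 1))%R by rewrite divr_gt0.
have /lb_ereal_inf_adherent : lebesgue_measure A \is a fin_num by rewrite A0.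
move=> /(_ _ d0)[_ [F [mF AF] <-]].
rewrite -[X in _ < X + _]/(lebesgue_measure A) A0 add0e => Fd.
apply: (@le_trans _ _ (\sum_(k <oo) wlength G_cumul (F k))).
  by apply: ereal_inf_lbound; exists F.
apply: (@le_trans _ _ (\sum_(k <oo) (2 * L + 1)%:E * wlength idfun (F k))).
  apply: lee_nneseries => [i _ _|i _]; first exact: wlength_ge0.
  apply: (le_trans (wlength_G_le (mF i))).
  by rewrite lee_wpmul2r ?lee_fin ?lerDl//; exact: wlength_ge0.
rewrite nneseriesZl; last by move=> i _; exact: wlength_ge0.
rewrite -lee_pdivlMl// -EFinM mulrC; exact: ltW.
Qed.

Let LS_oc (a b : R) : (a <= b)%R -> LS `]a, b]%classic = (G b - G a)%:E.
Proof.
move=> ab; rewrite /LS /lebesgue_stieltjes_measure /measure_extension.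
rewrite measurable_mu_extE/=; last exact: is_ocitv.
by rewrite wlength_itv_bnd.
Qed.

(** Domination gives the Stieltjes measure of [G] a Radon-Nikodym density; up to a constant [G] is
    its indefinite integral, which is derivable almost everywhere by Lebesgue differentiation. *)
Lemma lipschitz_ae_derivable (a b : R) : (a < b)%R ->
  {ae @lebesgue_measure R, forall x, x \in `]a, b[ -> derivable g x 1}.
Proof.
move=> ab.
have mD : measurable (`]a, b]%classic : set (measurableTypeR R)).
  exact: measurable_itv.
have LSoo : LS `]a, b]%classic < +oo by rewrite LS_oc ?ltW// ltry.
pose nu := mfrestr mD LSoo.
have /radon_nikodym_sigma_finite : nu `<< @lebesgue_measure R.
  apply/null_content_dominatesP => A mA A0.
  apply/eqP; rewrite eq_le measure_ge0 andbT.
  rewrite -[leRHS](LS_dominated A0) /nu /mfrestr /mrestr.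
  by apply: le_measure; [rewrite inE; exact: measurableI|rewrite inE|
    exact: subIsetl].
move=> [f [f0 ffin fint fE]].
have fineE : f = EFin \o (fine \o f).
  by apply/funext => x /=; rewrite fineK.
have intf (A : set R) : measurable A ->
    lebesgue_measure.-integrable A (EFin \o (fine \o f)).
  by move=> mA; rewrite -fineE; apply: integrableS fint.
have := @FTC1 R (fine \o f) (BRight a) (fun y => intf _ (measurable_itv _)).
move=> /(_ (open_integrable_locally openT (intf _ measurableT)))/=.
apply: filterS; first exact: (ae_filter_ringOfSetsType lebesgue_measure).
move=> x + /[!in_itv]/= /andP[ax xb].
rewrite lte_fin => /(_ ax)[dF _].
set F := (fun _ : R => _) in dF.
have FE y : (a < y)%R -> (y <= b)%R -> F y = (G y - G a)%R.
  move=> ay yb; rewrite /F /Rintegral.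
  under eq_integral do rewrite fineK//.
  rewrite -fE//.
  rewrite /= /mfrestr /mrestr setIidl; last first.
    by apply: subset_itvl; rewrite bnd_simp.
  by rewrite -/LS LS_oc// ltW.
have dG : derivable G x 1.
  have : derivable (F \+ cst (G a))%R x 1.
    by apply: derivableD; [exact: dF|exact: derivable_cst].
  apply: near_eq_derivable.
  have := lt_le_nbhsl xb; have := lt_nbhsr ax.
  by apply: filterS2 => y ay yb /=; rewrite FE ?subrK.
have -> : g = (G \- (fun z => L * z))%R by apply/funext => z/=; rewrite /G addrK.
apply: derivableB; first exact: dG.
by apply: derivableM; [exact: derivable_cst|exact: derivable_id].
Qed.

End LipschitzRealFunction.

(** * Row vectors in the sup norm *)

Section RowVectors.
Variables (R : realType) (n : nat).
Implicit Types u v : 'rV[R]_n.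

Lemma le_normr_coord v i : `|v ord0 i| <= `|v|.
Proof.
rewrite [leRHS]/Num.norm /= mx_normrE.
exact: (le_bigmax_cond _ (fun ij => `|v ij.1 ij.2|) (j := (ord0, i))).
Qed.

Lemma normr_row_le v (e : R) : 0 <= e ->
  (forall i, `|v ord0 i| <= e) -> `|v| <= e.
Proof.
move=> e0 ve; rewrite [leLHS]/Num.norm /= mx_normrE.
by apply/bigmax_leP; split=> // -[i j] _ /=; rewrite ord1.
Qed.

Lemma normr_row_lt v (e : R) : 0 < e ->
  (forall i, `|v ord0 i| < e) -> `|v| < e.
Proof.
move=> e0 ve; rewrite [ltLHS]/Num.norm /= mx_normrE.
by apply/bigmax_ltP; split=> // -[i j] _ /=; rewrite ord1.
Qed.

Lemma normr_delta_row (i : 'I_n) : `|delta_mx ord0 i : 'rV[R]_n| = 1.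
Proof.
apply/eqP; rewrite eq_le; apply/andP; split.
  by apply: normr_row_le => // j; rewrite mxE; case: (_ && _); rewrite ?normr1 ?normr0.
by apply: le_trans (le_normr_coord _ i); rewrite mxE !eqxx normr1.
Qed.

Lemma dense_rat_row v (e : R) : 0 < e ->
  exists q : 'rV[rat]_n, `|v - map_mx ratr q| < e.
Proof.
move=> e0.
have H i : exists q : rat, `|v ord0 i - ratr q| < e.
  have [q] := @rat_in_itvoo R (v ord0 i - e) (v ord0 i + e) ltac:(lra).
  rewrite in_itv/= => qe; exists q; rewrite ltr_norml; lra.
have [q qH] := choice H.
exists (\row_i q i); apply: normr_row_lt => // i.
by rewrite !mxE.
Qed.

End RowVectors.

(** * Measurability tested on coordinates *)

Section Measurability.
Context d (T : measurableType d) (R : realType).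

Lemma measurable_forall_countable (I : countType) (P : I -> T -> Prop) :
  (forall i, measurable [set y | P i y]) -> measurable [set y | forall i, P i y].
Proof.
move=> mP.
rewrite (_ : mkset _ = \bigcap_(n in setT)
    [set y | if unpickle n is Some i then P i y else True]).
  apply: bigcapT_measurable => n; case: unpickle => [i|]; first exact: mP.
  by rewrite (_ : mkset _ = setT)//; apply/seteqP; split.
apply/seteqP; split => [y Py n _ /=|y Py i]; first by case: unpickle => //.
by have := Py (pickle i) Logic.I; rewrite /= pickleK.
Qed.

Lemma measurable_exists_nat (P : nat -> T -> Prop) :
  (forall i, measurable [set y | P i y]) -> measurable [set y | exists i, P i y].
Proof.
move=> mP; rewrite (_ : mkset _ = \bigcup_n [set y | P n y]).
  exact: bigcupT_measurable.
by apply/seteqP; split => [y [i Pi]|y [i _ Pi]]; exists i.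
Qed.

Definition measurable_coords n (psi : T -> 'rV[R]_n) :=
  forall j, measurable_fun setT (fun y => psi y ord0 j).

Lemma measurable_coords_ball n (psi : T -> 'rV[R]_n) q (e : R) : 0 < e ->
  measurable_coords psi -> measurable [set y | `|psi y - q| < e].
Proof.
move=> e0 mpsi.
rewrite (_ : mkset _ = [set y | forall i, `|psi y ord0 i - q ord0 i| < e]).
  apply: measurable_forall_countable => i.
  have mf : measurable_fun setT (fun y => `|psi y ord0 i - q ord0 i|).
    by apply: measurableT_comp => //; exact: measurable_funB (mpsi i) (measurable_cst _).
  have := mf measurableT _ (measurable_itv `]-oo, e[).
  rewrite setTI; congr (measurable _).
apply/seteqP; split => [y /= ye i|y /= ye].
  by apply: le_lt_trans ye; have := le_normr_coord (psi y - q) i; rewrite !mxE.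
by apply: normr_row_lt => // i; rewrite !mxE.
Qed.

(** An open set is the union of the countably many balls selected by [good], with rational centres
    and radii [p.2.+1%:R^-1]; the complement is treated as a countable intersection. *)
Lemma measurable_coords_open n (psi : T -> 'rV[R]_n) O : open O ->
  measurable_coords psi -> measurable (psi @^-1` O).
Proof.
move=> oO mpsi.
pose good (p : 'rV[rat]_n * nat) :=
  `[< forall z : 'rV[R]_n, `|z - map_mx ratr p.1| < p.2.+1%:R^-1 -> O z >].
rewrite -(setCK (_ @^-1` _)); apply: measurableC.
rewrite (_ : ~` _ = [set y | forall p, good p ->
    ~ `|psi y - map_mx ratr p.1| < p.2.+1%:R^-1]).
  apply: measurable_forall_countable => p; case: (good p); last first.
    by rewrite (_ : mkset _ = setT)//; apply/seteqP; split.
  rewrite (_ : mkset _ =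
      ~` [set y | `|psi y - map_mx ratr p.1| < p.2.+1%:R^-1]).
    by apply: measurableC; apply: measurable_coords_ball => //; rewrite invr_gt0.
  by apply/seteqP; split => y /=; [exact|].
apply/seteqP; split => [y /= Oy p /asboolP gp yp|y /= H Oy].
  by apply: Oy; exact: gp.
have /nbhs_ballP[e /= e0] := oO _ Oy.
rewrite -ball_normE => yO.
(* With a radius below [e / 2], a ball that contains [psi y] stays within [e] of it. *)
have [k] : exists k : nat, (k.+1%:R^-1 : R) < e / 2.
  have [k _ /(_ k (leqnn _))] := near_infty_natSinv_lt (PosNum (divr_gt0 e0 (ltr0n R 2))).
  by exists k.
move=> ke.
have [q yq] : exists q : 'rV[rat]_n, `|psi y - map_mx ratr q| < k.+1%:R^-1.
  by apply: dense_rat_row; rewrite invr_gt0.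
apply: (H (q, k)) => //; apply/asboolP => z /= zq; apply: yO => /=.
rewrite -(subrK (map_mx ratr q) (psi y)) -addrA.
apply: (le_lt_trans (ler_normD _ _)); rewrite (distrC _ z) [e]splitr.
by rewrite ltrD// (lt_trans _ ke).
Qed.

Lemma measurable_coords_comp n (psi : T -> 'rV[R]_n) (G : 'rV[R]_n -> R) :
  continuous G -> measurable_coords psi -> measurable_fun setT (G \o psi).
Proof.
move=> /continuousP cG mpsi; apply: (measurability _ (RGenOpens.measurableE R)).
move=> _ [_ [a [b ->] <-]]; rewrite setTI comp_preimage.
by apply: measurable_coords_open => //; apply: cG; exact: interval_open.
Qed.

End Measurability.

(** * Null sets of product measures *)

Section Fubini.
Variables (R : realType).
Local Open Scope ereal_scope.

Lemma null_of_null_xsections d1 d2 (T1 : measurableType d1)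
    (T2 : measurableType d2) (m1 : {sigma_finite_measure set T1 -> \bar R})
    (m2 : {sigma_finite_measure set T2 -> \bar R}) (A : set (T1 * T2)) :
  (forall x, m2 (xsection A x) = 0) -> (m1 \x m2) A = 0.
Proof. by move=> A0; rewrite /product_measure1 integral0_eq// => x _ /=. Qed.

Lemma null_of_null_ysections d1 d2 (T1 : measurableType d1)
    (T2 : measurableType d2) (m1 : {sigma_finite_measure set T1 -> \bar R})
    (m2 : {sigma_finite_measure set T2 -> \bar R}) (A : set (T1 * T2)) :
  measurable A ->
  (forall y, m1 (ysection A y) = 0) -> (m1 \x m2) A = 0.
Proof.
move=> mA A0.
rewrite (product_measure_unique (m' := m1 \x^ m2))//=.
  by rewrite /product_measure2 integral0_eq// => x _ /=.
by move=> *; rewrite product_measure2E.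
Qed.

End Fubini.

Section FiniteProductMeasure.
Local Open Scope ereal_scope.
Context d1 d2 (T1 : measurableType d1) (T2 : measurableType d2) (R : realType).
Variables (m1 : {finite_measure set T1 -> \bar R})
  (m2 : {finite_measure set T2 -> \bar R}).

(* The library infers a finite measure from [m1 \x m2] only for probabilities,
   hence this alias. *)
Definition finite_product := m1 \x m2.

HB.instance Definition _ := Measure.on finite_product.

Let finite_product_fin_num : fin_num_fun finite_product.
Proof.
move=> A mA; rewrite ge0_fin_numE ?measure_ge0//.
apply: (@le_lt_trans _ _ (finite_product setT)).
  by rewrite le_measure ?inE.
rewrite /finite_product -setXTT product_measure1E// lte_mul_pinfty//.
  exact: fin_num_measure.
by rewrite ltey_eq fin_num_measure.
Qed.

HB.instance Definition _ :=
  Measure_isFinite.Build _ _ _ finite_product finite_product_fin_num.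

End FiniteProductMeasure.

(** * Points common to sets conull on lines parallel to the axes *)

Section PointOnConullLines.
Variables (R : realType) (k : nat) (c : 'rV[R]_k) (r : R).
Hypothesis r0 : 0 < r.

(** Stands in for Borel measurability: only preimages under coordinatewise measurable maps are ever
    measured. *)
Definition coordwise_measurable (B : set 'rV[R]_k) :=
  forall d (T : measurableType d) (psi : T -> 'rV[R]_k),
    measurable_coords psi -> measurable (psi @^-1` B).

Definition conull_on_lines (i : 'I_k) (B : set 'rV[R]_k) :=
  forall x, {ae @lebesgue_measure R, forall t : R, t \in `]0, r[ ->
    B (x + t *: delta_mx ord0 i)}.

(** Keeps samples bounded for every real [t], and changes nothing on []0, r[], where [nu] is
    concentrated. *)
Let clamp (t : R) := Num.min (Num.max t 0) r.

Let clampE t : t \in `]0, r[ -> clamp t = t.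
Proof.
by rewrite in_itv/= => /andP[t0 tr]; rewrite /clamp max_l ?min_l// ltW.
Qed.

Let clamp_bound t : `|clamp t| <= r.
Proof.
rewrite /clamp ger0_norm; last by rewrite le_min le_max lexx orbT ltW.
by rewrite ge_min lexx orbT.
Qed.

Let measurable_clamp : measurable_fun setT clamp.
Proof.
apply: measurable_minr; last exact: measurable_cst.
by apply: measurable_maxr; [exact: measurable_id|exact: measurable_cst].
Qed.

Let mD : measurable (`]0, r[%classic : set (measurableTypeR R)).
Proof. exact: measurable_itv. Qed.

Let muD : (@lebesgue_measure R (`]0%R, r[)%classic < +oo)%E.
Proof. by rewrite lebesgue_measure_itv /= lte_fin r0 -EFinB ltry. Qed.

Let nu : {finite_measure set (measurableTypeR R) -> \bar R} := mfrestr mD muD.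

Let nuT : (0 < nu setT)%E.
Proof.
rewrite /nu /= /mfrestr /mrestr setTI lebesgue_measure_itv /= lte_fin r0.
by rewrite -EFinB lte_fin subr0.
Qed.

(* The first [n] coordinates are made independent and uniform, one at a time. *)
Let exists_sample_space (n : nat) : (n <= k)%N ->
  exists d (Y : measurableType d) (P : {finite_measure set Y -> \bar R})
    (phi : Y -> 'rV[R]_k),
  [/\ measurable_coords phi,
      (0 < P setT)%E,
      (forall y (j : 'I_k), `|phi y ord0 j - c ord0 j| <=
        if (j < n)%N then r else 0) &
      forall (i : 'I_k) B, (i < n)%N ->
      coordwise_measurable B -> conull_on_lines i B ->
        P (phi @^-1` ~` B) = 0%E].
Proof.
elim: n => [_|n IH nk].
  exists _, _, nu, (cst c); split => //.
    by move=> y j /=; rewrite subrr normr0.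
have [d [Y [P [phi [mphi PT phib phiB]]]]] := IH (ltnW nk).
pose i0 := Ordinal nk.
pose psi (z : Y * measurableTypeR R) := phi z.1 + clamp z.2 *: delta_mx ord0 i0.
have mpsi : measurable_coords psi.
  move=> j; rewrite /psi.
  rewrite (_ : (fun y => _) = (fun y : Y * measurableTypeR R => phi y.1 ord0 j +
     clamp y.2 * (delta_mx ord0 i0 : 'rV[R]_k) ord0 j)); last first.
    by apply/funext => z; rewrite !mxE.
  apply: measurable_funD.
    exact: (measurableT_comp (mphi j) measurable_fst).
  apply: measurable_funM; last exact: measurable_cst.
  exact: (measurableT_comp measurable_clamp measurable_snd).
exists _, _, (finite_product P nu), psi; split.
- exact: mpsi.
- rewrite /= /finite_product -setXTT product_measure1E// mule_gt0//.
- move=> [y t] j; rewrite !mxE /=.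
  have [->|ji] := eqVneq j i0.
    rewrite /= ltnSn mulr1; have := phib y i0; rewrite /= ltnn normr_le0 subr_eq0.
    by move=> /eqP->; rewrite addrAC subrr add0r.
  rewrite mulr0 addr0; suff -> : (j < n.+1)%N = (j < n)%N by exact: phib.
  rewrite ltnS leq_eqVlt; suff -> : (j == n :> nat) = false by [].
  by apply/negbTE; apply: contra ji => /eqP jn; apply/eqP/val_inj.
move=> i B; rewrite ltnS leq_eqVlt => iin mB cB.
have mE : measurable (psi @^-1` ~` B).
  by rewrite preimage_setC; apply: measurableC; exact: mB.
(* For the new coordinate, the section over [y] is a segment parallel to that axis, on which [B] has
   full measure. *)
have [/eqP iE|ii] := boolP (i == n :> nat).
  have {}iE : i = i0 by apply/val_inj.
  rewrite /= /finite_product; apply: null_of_null_xsections => y.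
  rewrite /nu /= /mfrestr /mrestr.
  have [A [mA A0 BA]] := cB (phi y).
  apply/eqP; rewrite eq_le measure_ge0 andbT -[leRHS]A0.
  apply: le_measure; rewrite ?inE//.
    by apply: measurableI => //; exact: measurable_xsection.
  move=> t [/xsectionP /= nB ti]; apply: BA => /= H.
  by apply: nB; rewrite /psi /= clampE// -iE; exact: H.
(* For an earlier coordinate, fixing [t] translates [B]; the translate is again measurable and
   conull on lines, so the induction hypothesis applies to it. *)
rewrite (negbTE ii)/= in iin.
rewrite /= /finite_product; apply: null_of_null_ysections => // t.
have := phiB i [set x | B (x + clamp t *: delta_mx ord0 i0)] iin.
rewrite (_ : ysection _ _ = phi @^-1` (~` [set x | B (x + clamp t *: delta_mx ord0 i0)])); last first.
  by apply/seteqP; split => y /=; rewrite /ysection/= inE.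
apply.
  move=> d' T' psi' mpsi'.
  rewrite (_ : _ @^-1` _ = (fun y => psi' y + clamp t *: delta_mx ord0 i0) @^-1` B)//.
  apply: mB => j.
  rewrite (_ : (fun y => _) = (fun y => psi' y ord0 j + (clamp t *: (delta_mx ord0 i0 : 'rV[R]_k)) ord0 j)); last first.
    by apply/funext => z; rewrite !mxE.
  by apply: measurable_funD => //; exact: measurable_cst.
move=> x; have := cB (x + clamp t *: delta_mx ord0 i0).
apply: filterS; first exact: (ae_filter_ringOfSetsType lebesgue_measure).
by move=> s /= H /H; rewrite addrAC.
Qed.

(** Finitely many null sets cannot cover a sample space of positive measure; a sample outside them
    suits all [B l i] at once. *)
Lemma exists_point_of_conull_on_lines (I : finType) (B : I -> 'I_k -> set 'rV[R]_k) :
  (forall l i, coordwise_measurable (B l i)) ->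
  (forall l i, conull_on_lines i (B l i)) ->
  exists2 b, `|b - c| <= r & forall l i, B l i b.
Proof.
move=> mB cB.
have [d [Y [P [phi [mphi PT phib phiB]]]]] := exists_sample_space (leqnn k).
suff [y Hy] : exists y, forall p : I * 'I_k, B p.1 p.2 (phi y).
  exists (phi y); last by move=> l i; exact: (Hy (l, i)).
  apply: normr_row_le => [|j]; first exact: ltW.
  by rewrite !mxE; have := phib y j; rewrite ltn_ord.
apply: contrapT => /forallNP H.
have PE : P (\big[setU/set0]_(p <- enum {: I * 'I_k}) (phi @^-1` ~` B p.1 p.2)) = 0%E.
  elim: (enum _) => [|p s IHs]; first by rewrite big_nil measure0.
  have mp (q : I * 'I_k) : measurable (phi @^-1` ~` B q.1 q.2).
    by rewrite preimage_setC; apply: measurableC; exact: mB.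
  rewrite big_cons; apply: null_set_setU => //.
    by apply: bigsetU_measurable => q _; exact: mp.
  exact: phiB p.2 (B p.1 p.2) (ltn_ord _) (mB _ _) (cB _ _).
suff TE : setT = \big[setU/set0]_(p <- enum {: I * 'I_k}) (phi @^-1` ~` B p.1 p.2).
  by move: PT; rewrite TE PE ltxx.
apply/esym/seteqP; split => // y _.
have [p Bp] : exists p : I * 'I_k, ~ B p.1 p.2 (phi y) by apply/existsNP; exact: H.
rewrite -bigcup_seq; exists p => //=; rewrite mem_enum//.
Qed.

End PointOnConullLines.

(** * Partial derivatives of Lipschitz maps *)

Section PartialDerivatives.
Variables (R : realType) (k : nat).
Implicit Types (f : 'rV[R]_k -> R) (x e : 'rV[R]_k).

Lemma derivable_littleo f x e : derivable f x e ->
  exists a, forall eps, 0 < eps ->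
    \forall t \near (0 : R), `|f (x + t *: e) - f x - t * a| <= eps * `|t|.
Proof.
move=> /cvg_ex[a /cvgrPdist_le H]; exists a => eps eps0.
have := H _ eps0; rewrite near_withinE; apply: filterS => t.
have [->|t0 /(_ isT) /= Ht] := eqVneq t 0.
  by rewrite scale0r addr0 subrr mul0r subrr normr0 mulr0.
rewrite -ler_pdivrMr ?normr_gt0// -normfV -normrM; apply: le_trans Ht.
rewrite distrC [t *: e + x]addrC le_eqVlt; apply/orP; left; apply/eqP; congr `|_|.
by rewrite -[t^-1 *: _]/(t^-1 * _) mulrBl; congr (_ - _); [rewrite mulrC|rewrite (mulrC t) mulfK].
Qed.

Definition diff_quotient f x e (t : R) := t^-1 * (f (x + t *: e) - f x).

(* Quantifying over rational increments makes derivability a countable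
   combination of closed conditions on the point. *)
Lemma derivable_rat_cauchy f x e : continuous f ->
  derivable f x e <->
  forall n : nat, exists j : nat, forall p : rat * rat,
    p.1 != 0 -> p.2 != 0 ->
    `|ratr p.1 : R| < j.+1%:R^-1 -> `|ratr p.2 : R| < j.+1%:R^-1 ->
    `|diff_quotient f x e (ratr p.1) - diff_quotient f x e (ratr p.2)|
      <= n.+1%:R^-1.
Proof.
move=> cf; pose q := diff_quotient f x e.
have dE : derivable f x e = cvg (q @ 0^').
  rewrite /derivable; suff -> : q =
    fun h => h^-1 *: ((f \o shift x) (h *: e) - f x) by [].
  by apply/funext => t /=; rewrite /q /diff_quotient [t *: e + x]addrC.
rewrite dE; split.
  move=> /cvg_ex[a /cvgrPdist_lt H] n.
  have n0 : 0 < n.+1%:R^-1 / 2 :> R by rewrite divr_gt0// invr_gt0.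
  move: (n.+1%:R^-1 : R) n0 => u n0.
  have := H _ n0; rewrite near_withinE => -[/= d d0 Hd].
  have [j _ /(_ j (leqnn _)) jd] := near_infty_natSinv_lt (PosNum d0).
  exists j => -[s t] /= s0 t0 sj tj.
  have {}Hd (p : rat) : p != 0 -> `|ratr p : R| < j.+1%:R^-1 ->
      `|a - q (ratr p)| < u / 2.
    move=> p0 pj; apply: Hd; last by rewrite fmorph_eq0.
    by rewrite /= sub0r normrN (lt_trans pj).
  have := Hd _ s0 sj; have := Hd _ t0 tj; rewrite -/q => H1 H2.
  rewrite (_ : _ - _ = (a - q (ratr t)) - (a - q (ratr s))); last by ring.
  apply: (le_trans (ler_normB _ _)); rewrite [leRHS]splitr.
  exact: lerD (ltW H1) (ltW H2).
(* [cauchy_exP] asks for one centre per [eps]: it will be the quotient at a rational increment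
   [s0]. *)
move=> H; apply: cauchy_cvg; apply: cauchy_exP => eps eps0.
have [n _ /(_ n (leqnn _)) /= neps] := near_infty_natSinv_lt (PosNum eps0).
have [j {}H] := H n.
have : (0 : R) < j.+1%:R^-1 by rewrite invr_gt0.
move: (j.+1%:R^-1 : R) (n.+1%:R^-1 : R) H neps => w u H ueps w0.
have cq (t : R) : t != 0 -> {for t, continuous q}.
  move=> t0; apply: cvgM; first exact: cvgV.
  apply: cvgB; last exact: cvg_cst.
  apply: continuous_comp; last exact: cf.
  apply: cvgD; first exact: cvg_cst.
  by apply: cvgZr_tmp; exact: cvg_id.
(* real increments are handled by continuity of the quotient away from 0 *)
have near_rat (t e1 : R) : t != 0 -> `|t| < w -> 0 < e1 ->
    exists2 p : rat, p != 0 /\ `|ratr p : R| < w &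
      `|q t - q (ratr p)| < e1.
  move=> t0 tj e10.
  have /cvgrPdist_lt/(_ _ e10) [/= d d0 Hd] := cq t t0.
  pose m := Num.min d (Num.min `|t| (w - `|t|)).
  have m0 : 0 < m by rewrite !lt_min d0 normr_gt0 t0 subr_gt0.
  have [p] := @rat_in_itvoo R (t - m) (t + m) ltac:(lra).
  rewrite in_itv/= => pm.
  have {pm} : `|t - ratr p| < m by rewrite ltr_norml; lra.
  rewrite !lt_min => /and3P[pd pt pj].
  exists p; last exact: Hd.
  split.
    by apply: contraTneq pt => ->; rewrite raddf0 subr0 ltxx.
  rewrite -(subrK t (ratr p)); apply: (le_lt_trans (ler_normD _ _)).
  by rewrite -ltrBrDr distrC.
have [s0 [s0n s0j]] : exists s : rat, s != 0 /\ `|ratr s : R| < w.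
  have := @near_rat (w / 2) 1.
  have w2 : 0 < w / 2 by rewrite divr_gt0.
  rewrite (gt_eqF w2) (gtr0_norm w2) => /(_ isT); case.
  - lra.
  - exact: ltr01.
  - by move=> p pw _; exists p; exact: pw.
exists (q (ratr s0)).
change (\forall t \near (0:R)^', ball (q (ratr s0)) eps (q t)).
rewrite near_withinE.
exists w; first exact: w0.
move=> t /=; rewrite sub0r normrN => tj t0.
rewrite -ball_normE /=.
have e20 : 0 < eps - u by rewrite subr_gt0.
have [p [p0 pj] ptq] := @near_rat t _ t0 tj e20.
have := H (s0, p) s0n p0 s0j pj; rewrite -/(q _) -/(q _) /= => H1.
rewrite -(subrK (q (ratr p)) (q (ratr s0))) -addrA.
apply: (le_lt_trans (ler_normD _ _)).
rewrite (distrC _ (q t)); lra.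
Qed.

Lemma coordwise_measurable_derivable f e : continuous f ->
  coordwise_measurable [set x | derivable f x e].
Proof.
move=> cf d T psi mpsi.
rewrite (_ : _ @^-1` _ = [set y | forall n : nat, exists j : nat,
    forall p : rat * rat, p.1 != 0 -> p.2 != 0 ->
    `|ratr p.1 : R| < j.+1%:R^-1 -> `|ratr p.2 : R| < j.+1%:R^-1 ->
    `|diff_quotient f (psi y) e (ratr p.1) -
      diff_quotient f (psi y) e (ratr p.2)| <= n.+1%:R^-1]); last first.
  by apply/seteqP; split => y /= /(derivable_rat_cauchy _ _ cf).
apply: measurable_forall_countable => n.
apply: measurable_exists_nat => j.
apply: measurable_forall_countable => -[s t] /=.
have mT : measurable (setT : set T) by exact: measurableT.
have [s0|_] := eqVneq s 0.
  by rewrite (_ : mkset _ = setT)//; apply/seteqP; split.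
have [t0|_] := eqVneq t 0.
  by rewrite (_ : mkset _ = setT)//; apply/seteqP; split.
have [_|sj] := ltP `|ratr s : R|; last first.
  by rewrite (_ : mkset _ = setT)//; apply/seteqP; split.
have [_|tj] := ltP `|ratr t : R|; last first.
  by rewrite (_ : mkset _ = setT)//; apply/seteqP; split.
have mq (u : R) : measurable_fun setT (fun y => diff_quotient f (psi y) e u).
  apply: measurable_funM; first exact: measurable_cst.
  apply: measurable_realfun.measurable_funB; last first.
    exact: (measurable_coords_comp cf mpsi).
  apply: (measurable_coords_comp (psi := fun y => psi y + u *: e) cf) => i.
  rewrite (_ : (fun y => _) = (fun y => psi y ord0 i + (u *: e) ord0 i)).
    by apply: measurable_funD => //; exact: measurable_cst.
  by apply/funext => y; rewrite !mxE.
have mf : measurable_fun setT (fun y => `|diff_quotient f (psi y) e (ratr s) -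
    diff_quotient f (psi y) e (ratr t)|).
  by apply: measurableT_comp => //; exact: measurable_realfun.measurable_funB.
have := mf mT _ (measurable_itv `]-oo, n.+1%:R^-1]).
rewrite setTI; congr measurable; apply/seteqP; split => y /=.
  by rewrite in_itv/=.
by rewrite in_itv/=; exact.
Qed.

(** Along a line [f] is a Lipschitz function of [t] with the same [L], because basis vectors have
    norm 1; Lebesgue's theorem in one variable applies. *)
Lemma conull_on_lines_derivable f (L r : R) (i : 'I_k) : 0 < r ->
  (forall x y, `|f x - f y| <= L * `|x - y|) ->
  conull_on_lines r i [set x | derivable f x (delta_mx ord0 i)].
Proof.
move=> r0 fL x; set e := delta_mx ord0 i.
pose g (t : R) := f (x + t *: e).
have gL s t : `|g s - g t| <= L * `|s - t|.
  apply: (le_trans (fL _ _)).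
  rewrite opprD addrACA subrr add0r -scalerBl normrZ.
  by rewrite normr_delta_row mulr1.
have := lipschitz_ae_derivable gL r0.
apply: filterS; first exact: (ae_filter_ringOfSetsType lebesgue_measure).
move=> t + /[dup] tr => /[apply].
rewrite /= /derivable; set q1 := (q in cvg (q @ _)); set q2 := (q in _ -> cvg (q @ _)).
suff -> : q1 = q2 by [].
apply/funext => h; rewrite /q1 /q2 /g /=; congr (_ *: (f _ - _)).
by rewrite [_%:A]mulr1 addrCA scalerDl.
Qed.

(** There are finitely many pairs of a component [l] and an axis [i], so a single [b] serves them
    all; the components then assemble into vectors. *)
Lemma lipschitz_partial_derivatives n (F : 'rV[R]_k -> 'rV[R]_n) (L : R) c r :
  0 <= L -> 0 < r -> (forall x y, `|F x - F y| <= L * `|x - y|) ->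
  exists2 b, `|b - c| <= r & forall i, exists v : 'rV[R]_n,
    forall eps, 0 < eps -> \forall t \near (0 : R),
      `|F (b + t *: delta_mx ord0 i) - F b - t *: v| <= eps * `|t|.
Proof.
move=> L0 r0 FL; pose f (l : 'I_n) x := F x ord0 l.
have fL l x y : `|f l x - f l y| <= L * `|x - y|.
  apply: (le_trans _ (FL x y)).
  by have := le_normr_coord (F x - F y) l; rewrite !mxE.
have [b bc bD] := @exists_point_of_conull_on_lines R k c r r0 'I_n
  (fun l i => [set x | derivable (f l) x (delta_mx ord0 i)])
  (fun l i => coordwise_measurable_derivable (delta_mx ord0 i) (lipschitz_continuous L0 (fL l)))
  (fun l i => conull_on_lines_derivable i r0 (fL l)).
exists b => // i.
have [a aH] := choice (fun l => derivable_littleo (bD l i)).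
exists (\row_l a l) => eps eps0.
have := @filter_forall _ _ (fun l t =>
  `|f l (b + t *: delta_mx ord0 i) - f l b - t * a l| <= eps * `|t|)
  (nbhs (0 : R)) _ (fun l => aH l eps eps0).
move=> /(_ (nbhs_filter _)); apply: filterS => t H; apply: normr_row_le => [|l].
  by rewrite mulr_ge0// ltW.
by rewrite !mxE; exact: H.
Qed.

End PartialDerivatives.

(** * Derivatives as matrices *)

Section MatrixNorm.
Variable R : realType.

Lemma le_normr_entry m n (A : 'M[R]_(m, n)) i j : `|A i j| <= `|A|.
Proof.
rewrite [leRHS]/Num.norm /= mx_normrE.
exact: (le_bigmax_cond _ (fun ij => `|A ij.1 ij.2|) (j := (i, j))).
Qed.

(** For the sup norms, [m] times the norm of [A] bounds the operator norm; the added 1 makes the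
    bound positive, hence a legitimate divisor. *)
Definition mx_bound m n (A : 'M[R]_(m, n)) : R := m%:R * `|A| + 1.

Lemma mx_bound_gt0 m n (A : 'M[R]_(m, n)) : 0 < mx_bound A.
Proof. by rewrite ltr_wpDl// mulr_ge0. Qed.

Lemma normr_mulmx_le m n (v : 'rV[R]_m) (A : 'M[R]_(m, n)) :
  `|v *m A| <= mx_bound A * `|v|.
Proof.
have H : 0 <= m%:R * `|A| * `|v| by rewrite !mulr_ge0.
apply: (@le_trans _ _ (m%:R * `|A| * `|v|)); last first.
  by rewrite ler_wpM2r// lerDl.
apply: normr_row_le => // j; rewrite mxE.
apply: (le_trans (ler_norm_sum _ _ _)).
apply: (@le_trans _ _ (\sum_(i < m) `|A| * `|v|)).
  apply: ler_sum => i _; rewrite normrM mulrC.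
  by rewrite ler_pM// ?le_normr_entry// le_normr_coord.
by rewrite sumr_const card_ord -mulrnAl -[_ *+ m]mulr_natl.
Qed.

Lemma mulmx_continuous m n (A : 'M[R]_(m, n)) :
  continuous (fun v : 'rV[R]_m => v *m A).
Proof.
move=> v; apply/(@cvgrPdist_lt _ _ _ (nbhs v)) => e e0.
apply/nbhs_ballP; exists (e / mx_bound A) => /=.
  by rewrite divr_gt0// mx_bound_gt0.
move=> w; rewrite -ball_normE /= ltr_pdivlMr ?mx_bound_gt0// mulrC => H.
by rewrite -mulmxBl; apply: le_lt_trans H; exact: normr_mulmx_le.
Qed.

End MatrixNorm.

Section MatrixDerivative.
Variable R : realType.

(** The Frechet derivative as a matrix acting on rows from the right, so that the chain rule
    multiplies in the order of application. *)
Definition mxderiv m n (f : 'rV[R]_m -> 'rV[R]_n) x (A : 'M[R]_(m, n)) :=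
  forall e, 0 < e -> exists2 d, 0 < d & forall z, `|z - x| < d ->
    `|f z - f x - (z - x) *m A| <= e * `|z - x|.

Lemma differentiable_mxderiv m n (f : 'rV[R]_m -> 'rV[R]_n) x :
  differentiable f x -> exists A, mxderiv f x A.
Proof.
move=> /diff_locally df; exists (lin1_mx ('d f x)) => e e0.
have /eqaddoP/(_ _ e0) := df.
move=> /nbhs_ballP[/= d d0 H]; exists d => // z zx.
have := H (z - x); rewrite -ball_normE /= sub0r normrN => /(_ zx).
by rewrite mul_rV_lin1 !fctE /= subrK opprD addrA.
Qed.

Lemma mxderiv_differentiable m n (f : 'rV[R]_m -> 'rV[R]_n) x A :
  mxderiv f x A -> differentiable f x.
Proof.
move=> fA; pose df : {linear 'rV[R]_m -> 'rV[R]_n} := mulmxr A.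
have cdf : continuous df by exact: mulmx_continuous.
have Hf : f \o shift x = cst (f x) + df +o_ (0 : 'rV[R]_m) id.
  apply/eqaddoP => e e0; have [d d0 H] := fA e e0.
  apply/nbhs_ballP; exists d => //= z; rewrite -ball_normE /= sub0r normrN => zd.
  have := H (z + x); rewrite addrK => /(_ zd).
  by rewrite !fctE /= opprD addrA.
apply/diff_locallyP; rewrite (diff_unique cdf Hf); split => //.
Qed.

Lemma mxderiv_bound m n (f : 'rV[R]_m -> 'rV[R]_n) x A : mxderiv f x A ->
  exists2 d, 0 < d & forall z, `|z - x| < d ->
    `|f z - f x| <= (mx_bound A + 1) * `|z - x|.
Proof.
move=> /(_ 1 ltr01)[d d0 H]; exists d => // z /H zx.
rewrite -(subrK ((z - x) *m A) (f z - f x)).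
apply: (le_trans (ler_normD _ _)).
have := normr_mulmx_le (z - x) A; lra.
Qed.

Lemma mxderiv_near m n (f : 'rV[R]_m -> 'rV[R]_n) x A : mxderiv f x A ->
  forall e, 0 < e -> exists2 d, 0 < d & forall z, `|z - x| < d ->
    `|f z - f x| < e.
Proof.
move=> /mxderiv_bound[d d0 H] e e0.
have b0 : 0 < mx_bound A + 1 by rewrite addr_gt0// mx_bound_gt0.
exists (Num.min d (e / (mx_bound A + 1))).
  by rewrite lt_min d0 divr_gt0.
move=> z; rewrite lt_min => /andP[/H zx].
by rewrite ltr_pdivlMr// mulrC; exact: le_lt_trans.
Qed.

Lemma mxderiv_eq_near m n (f g : 'rV[R]_m -> 'rV[R]_n) x A d : 0 < d ->
  (forall z, `|z - x| < d -> f z = g z) -> mxderiv f x A -> mxderiv g x A.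
Proof.
move=> d0 fg fA e e0; have [d' d'0 H] := fA e e0.
exists (Num.min d d'); first by rewrite lt_min d0.
move=> z; rewrite lt_min => /andP[zd zd'].
by rewrite -!fg ?subrr ?normr0//; exact: H.
Qed.

Lemma mxderiv_comp m n p (f : 'rV[R]_m -> 'rV[R]_n) (g : 'rV[R]_n -> 'rV[R]_p)
    x A B :
  mxderiv f x A -> mxderiv g (f x) B -> mxderiv (g \o f) x (A *m B).
Proof.
move=> fA gB e e0.
pose a := mx_bound A + 1; pose b := mx_bound B.
have a0 : 0 < a by rewrite addr_gt0// mx_bound_gt0.
have b0 : 0 < b by exact: mx_bound_gt0.
have [d1 d10 H1] := mxderiv_bound fA.
have e2 : 0 < e / 2 / a by rewrite !divr_gt0.
have [d2 d20 H2] := gB _ e2.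
have e3 : 0 < e / 2 / b by rewrite !divr_gt0.
have [d3 d30 H3] := fA _ e3.
have [d4 d40 H4] := mxderiv_near fA d20.
exists (Num.min d1 (Num.min d3 d4)); first by rewrite !lt_min d10 d30.
move=> z; rewrite !lt_min => /and3P[/H1 z1 /H3 z3 /H4/H2 z4] /=.
rewrite -(subrK ((f z - f x) *m B) (g (f z) - g (f x))) -addrA mulmxA -mulmxBl.
apply: (le_trans (ler_normD _ _)); rewrite [e]splitr mulrDl lerD//.
  apply: (le_trans z4); rewrite -mulrA ler_wpM2l//; first by rewrite ltW// divr_gt0.
  by rewrite mulrC ler_pdivrMr// mulrC.
apply: (le_trans (normr_mulmx_le _ _)).
by rewrite mulrC -ler_pdivlMr// mulrAC.
Qed.

Lemma mxderiv_id m (x : 'rV[R]_m) : mxderiv id x 1%:M.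
Proof.
move=> e e0; exists 1 => // z _.
by rewrite mulmx1 subrr normr0 mulr_ge0// ltW.
Qed.

Lemma mxderiv_mulmx m n (M : 'M[R]_(m, n)) x : mxderiv (mulmxr M) x M.
Proof.
move=> e e0; exists 1 => // z _.
by rewrite /= -mulmxBl subrr normr0 mulr_ge0// ltW.
Qed.

Lemma mxderivD m n (f g : 'rV[R]_m -> 'rV[R]_n) x A B :
  mxderiv f x A -> mxderiv g x B -> mxderiv (fun z => f z + g z) x (A + B).
Proof.
move=> fA gB e e0; have e2 : 0 < e / 2 by rewrite divr_gt0.
have [d d0 H] := fA _ e2; have [d' d'0 H'] := gB _ e2.
exists (Num.min d d'); first by rewrite lt_min d0.
move=> z; rewrite lt_min => /andP[/H zd /H' zd'].
rewrite [e]splitr mulrDl mulmxDr.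
rewrite (_ : _ - _ = (f z - f x - (z - x) *m A) + (g z - g x - (z - x) *m B)).
  by apply: (le_trans (ler_normD _ _)); exact: lerD.
by rewrite (opprD (f x)) (addrACA (f z)) (opprD ((z - x) *m A)) [LHS]addrACA.
Qed.

Lemma mxderiv_unique m n (f : 'rV[R]_m -> 'rV[R]_n) x A B :
  mxderiv f x A -> mxderiv f x B -> A = B.
Proof.
move=> fA fB; apply/row_matrixP => i; rewrite !rowE.
set v := delta_mx 0 i; apply/eqP; rewrite -subr_eq0 -mulmxBr -normr_le0.
apply/ler_addgt0Pr => e e0; rewrite add0r.
have e2 : 0 < e / 2 by rewrite divr_gt0.
have [d d0 H] := fA _ e2; have [d' d'0 H'] := fB _ e2.
pose t := Num.min d d' / 2.
have t0 : 0 < t by rewrite divr_gt0// lt_min d0.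
have : t < Num.min d d'.
  rewrite /t; have : 0 < Num.min d d' by rewrite lt_min d0.
  lra.
rewrite lt_min => /andP[td td'].
have zE : x + t *: v - x = t *: v by rewrite addrAC subrr add0r.
have tv : `|t *: v| = t by rewrite normrZ normr_delta_row mulr1 gtr0_norm.
have := H' (x + t *: v); have := H (x + t *: v).
rewrite zE tv => /(_ td) h /(_ td') h'.
rewrite -(ler_pM2l t0) -[X in X * `|_|](gtr0_norm t0) -normrZ scalemxAl mulmxBr.
move: h h'; set a := f _ - f x => h h'.
rewrite (_ : _ - _ = (a - (t *: v) *m B) - (a - (t *: v) *m A)); last first.
  by rewrite opprB [RHS]addrC addrA subrK.
apply: (le_trans (ler_normB _ _)); rewrite mulrC [e]splitr mulrDl.
exact: lerD.
Qed.

End MatrixDerivative.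

(** * Extraction of limits by compactness *)

Section Compactness.
Variables (R : realType) (V : normedModType R).

(** Witnesses at the scales [n.+1%:R^-1] cluster at some [w], and monotonicity turns the late ones
    into witnesses at any given scale. Limits of normalised secants are extracted this way. *)
Lemma compact_approx (K : set V) (S : R -> V -> Prop) : compact K ->
  (forall e e' w, e <= e' -> S e w -> S e' w) ->
  (forall e, 0 < e -> exists2 w, K w & S e w) ->
  exists2 w, K w & forall e, 0 < e -> exists w', [/\ K w', `|w' - w| < e & S e w'].
Proof.
move=> cK mS H.
have /choice[u uH] : forall n : nat, exists w, K w /\ S n.+1%:R^-1 w.
  by move=> n; have [w Kw Sw] := H n.+1%:R^-1 ltac:(by rewrite invr_gt0); exists w.
have uK : (u @ \oo) K by exists 0%N => // n _; exact: (uH n).1.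
have [w [Kw cw]] := cK (u @ \oo) _ uK.
exists w => // e e0.
have [N _ Ne] := near_infty_natSinv_lt (PosNum e0).
have uN : (u @ \oo) [set v | exists2 n, (N <= n)%N & v = u n].
  by exists N => // n /= Nn; exists n.
have [_ [[n Nn ->]]] := cw _ _ uN (nbhsx_ballx w e e0).
rewrite -ball_normE /= => un; exists (u n).
split; [exact: (uH n).1|by rewrite distrC|].
by apply: mS (uH n).2; exact/ltW/Ne.
Qed.

End Compactness.

Lemma closed_ball_rV_compact (R : realType) n (x : 'rV[R]_n) r :
  compact [set v : 'rV[R]_n | `|v - x| <= r].
Proof.
apply: bounded_closed_compact.
  exists (`|x| + r); split; first exact: num_real.
  move=> M xM v /= vx; apply/ltW; apply: le_lt_trans xM.
  rewrite -[v](subrK x) addrC; apply: (le_trans (ler_normD _ _)).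
  by rewrite lerD2l.
rewrite (_ : [set _ | _] = (fun v : 'rV[R]_n => `|v - x|) @^-1` [set t | t <= r])//.
apply: closed_comp; last exact: closed_le.
move=> v _; apply/(@cvgrPdist_lt _ _ _ (nbhs v)) => e e0.
apply/nbhs_ballP; exists e => //= w; rewrite -ball_normE /=.
apply: le_lt_trans; apply: (le_trans (ler_dist_dist _ _)).
by rewrite opprD addrACA subrr addr0.
Qed.

(** * Secant cones *)

Ltac row_ring := apply/rowP => ?; rewrite !mxE; ring.

Lemma ler_normD_eq (R : realType) (V : normedModType R) (a b c : V) :
  a = b + c -> `|a| <= `|b| + `|c|.
Proof. by move=> ->; exact: ler_normD. Qed.

Section Cones.
Variables (R : realType) (m : nat).
Implicit Types (K : set 'rV[R]_m) (x y z v : 'rV[R]_m).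

(* [secant_cone K 0 x] is the contingent cone of [K] at [x]. *)
Definition secant_cone K (C : R) x v :=
  forall e, 0 < e -> exists y z t,
    [/\ K y, K z, `|y - x| <= C * t, 0 < t < e & `|z - y - t *: v| < e * t].

(** Bouligand's paratingent cone: unlike in [secant_cone], the base [y] tends to [x] at a rate
    unrelated to [t]. *)
Definition paratingent_cone K x v :=
  forall e, 0 < e -> exists y z t,
    [/\ K y, K z, `|y - x| < e, 0 < t < e & `|z - y - t *: v| < e * t].

Lemma secant_cone_paratingent K C x v : secant_cone K C x v ->
  paratingent_cone K x v.
Proof.
have C0 : 0 < `|C| + 1 by rewrite ltr_wpDl.
move=> H e e0; have e1 : 0 < Num.min e (e / (`|C| + 1)).
  by rewrite lt_min e0 divr_gt0.
have [y [z [t [Ky Kz yx]]]] := H _ e1.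
rewrite lt_min ltr_pdivlMr// => /and3P[t0 te tC] zy.
exists y, z, t; split => //; rewrite ?t0//.
  apply: (le_lt_trans yx); apply: le_lt_trans tC.
  by rewrite mulrC ler_pM2l// (le_trans (ler_norm _))// lerDl.
by apply: (lt_le_trans zy); rewrite ler_pM2r// ge_min lexx.
Qed.

(** Reversed secants start at [z], whose distance to [x] may exceed that of [y] by the length of the
    secant: hence the larger constant. *)
Lemma secant_coneN K C x v : 0 <= C -> secant_cone K C x v ->
  secant_cone K (C + `|v| + 1) x (- v).
Proof.
move=> C0 H e e0; have e1 : 0 < Num.min e 1 by rewrite lt_min e0 ltr01.
have [y [z [t [Ky Kz yx /andP[t0]]]]] := H _ e1.
rewrite lt_min => /andP[te t1] zy; exists z, y, t.
have zx : `|z - x| <= `|z - y - t *: v| + (`|t *: v| + `|y - x|).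
  apply: (@le_trans _ _ (`|z - y - t *: v| + `|t *: v + (y - x)|)).
    by apply: ler_normD_eq; row_ring.
  by rewrite lerD2l ler_normD.
have m1 : Num.min e 1 <= 1 by rewrite ge_min lexx orbT.
have me : Num.min e 1 <= e by rewrite ge_min lexx.
move: zx zy; rewrite normrZ (gtr0_norm t0) => zx zy; split => //.
- by nra.
- by rewrite t0.
rewrite (_ : y - z - t *: - v = - (z - y - t *: v)); last by row_ring.
rewrite normrN; nra.
Qed.

Variable K : set 'rV[R]_m.

Definition local_map x y (f : 'rV[R]_m -> 'rV[R]_m) (A : 'M[R]_m) :=
  [/\ f x = y, mxderiv f x A &
    exists2 d, 0 < d & forall z, `|z - x| < d -> K z -> K (f z)].

(** Both ends of the secants lie within a multiple of [t] of [x], so the derivative at the single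
    point [x] controls both up to [o(t)]. Paratingent secants have no such bound, which is why the
    constant [C] is tracked. *)
Lemma secant_cone_map x y f A C v : 0 <= C -> local_map x y f A ->
  secant_cone K C x v -> secant_cone K ((mx_bound A + 1) * C) y (v *m A).
Proof.
move=> C0 [<- fA [d d0 Kf]] H e e0; clear y.
have a0 := mx_bound_gt0 A; set a := mx_bound A in a0 *.
(* [c] bounds the distances of both ends to [x] in units of [t]. One error of [e / 4] per end and
   one from the secant add up to less than [e]. *)
pose c := C + `|v| + 1.
have c0 : 0 < c by rewrite ltr_wpDl// addr_ge0.
pose e2 := e / 4 / c; have e20 : 0 < e2 by rewrite !divr_gt0.
have e2c : e2 * c = e / 4 by rewrite mulfVK// gt_eqF.
have [d1 d10 H1] := fA _ e20.
have [d2 d20 H2] := mxderiv_bound fA.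
pose d3 := Num.min d (Num.min d1 d2).
have d30 : 0 < d3 by rewrite !lt_min d0 d10.
pose e1 := Num.min (Num.min 1 e) (Num.min (e / 4 / a) (d3 / c)).
have e10 : 0 < e1 by rewrite !lt_min ltr01 e0 !divr_gt0.
have e11 : e1 <= 1 by rewrite !ge_min lexx.
have e1e : e1 <= e by rewrite !ge_min lexx !orbT.
have e1a : a * e1 <= e / 4 by rewrite mulrC -ler_pdivlMr// !ge_min lexx !orbT.
have e1d : c * e1 <= d3 by rewrite mulrC -ler_pdivlMr// !ge_min lexx !orbT.
have [y [z [t [Ky Kz yx /andP[t0 te] zy]]]] := H _ e10.
have zx : `|z - x| <= c * t.
  have : `|z - x| <= `|z - y - t *: v| + (`|t *: v| + `|y - x|).
    apply: (@le_trans _ _ (`|z - y - t *: v| + `|t *: v + (y - x)|)).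
      by apply: ler_normD_eq; row_ring.
    by rewrite lerD2l ler_normD.
  rewrite normrZ (gtr0_norm t0) => zx; rewrite /c; nra.
have yx' : `|y - x| <= c * t.
  apply: (le_trans yx); rewrite ler_pM2r// /c -addrA lerDl addr_ge0//.
have : c * t < d3 by apply: lt_le_trans e1d; rewrite ltr_pM2l.
rewrite !lt_min => /and3P[td td1 td2].
exists (f y), (f z), t; split.
- by apply: Kf => //; exact: le_lt_trans yx' td.
- by apply: Kf => //; exact: le_lt_trans zx td.
- apply: (le_trans (H2 _ (le_lt_trans yx' td2))).
  by rewrite -/a -mulrA ler_pM2l// addr_gt0.
- by rewrite t0/= (lt_le_trans te).
have h1 := H1 _ (le_lt_trans yx' td1); have h2 := H1 _ (le_lt_trans zx td1).
have h3 := normr_mulmx_le (z - y - t *: v) A.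
rewrite -/a in h3.
apply: (@le_lt_trans _ _ (`|f z - f x - (z - x) *m A| +
    (`|f y - f x - (y - x) *m A| + `|(z - y - t *: v) *m A|))).
  apply: (@le_trans _ _ (`|f z - f x - (z - x) *m A| +
    `|- (f y - f x - (y - x) *m A) + (z - y - t *: v) *m A|)).
    apply: ler_normD_eq; rewrite !mulmxBl scalemxAl.
    move: (z *m A) (y *m A) (x *m A) (v *m A) => p q r s; row_ring.
  by rewrite lerD2l; apply: (le_trans (ler_normD _ _)); rewrite normrN.
have h4 : e2 * `|z - x| <= e / 4 * t by rewrite -e2c -mulrA ler_pM2l.
have h5 : e2 * `|y - x| <= e / 4 * t by rewrite -e2c -mulrA ler_pM2l.
have h6 : a * `|z - y - t *: v| <= e / 4 * t.
  apply: (@le_trans _ _ (a * (e1 * t))); first by rewrite ler_pM2l// ltW.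
  by rewrite mulrA ler_pM2r.
have : 0 < e * t by rewrite mulr_gt0.
lra.
Qed.

End Cones.

(** * Choquet's theorem by nested balls *)

Section Choquet.
Variables (R : realType) (m : nat) (K O : set 'rV[R]_m).
Hypotheses (cK : compact K) (oO : open O).

Let index := ('rV[rat]_m * nat)%type.

(* Points of [K] seeing no other point of [K] in a truncated open cone. *)
Let avoids (i : index) (x : 'rV[R]_m) := forall y t, K y -> 0 < t < i.2.+1%:R^-1 ->
  i.2.+1%:R^-1 * t <= `|y - x - t *: map_mx ratr i.1|.

(** Pairs are a centre and a radius. The ball [s'] lies in [s], and condition [i] is decided on the
    ball of twice the radius, a neighbourhood of every point of [s']. *)
Let step (i : index) (s s' : 'rV[R]_m * R) :=
  [/\ K s'.1, 0 < s'.2, `|s'.1 - s.1| + s'.2 <= s.2 &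
    (forall z, K z -> `|z - s'.1| <= 2 * s'.2 -> avoids i z) \/
    (forall z, K z -> `|z - s'.1| <= 2 * s'.2 -> ~ avoids i z)].

(** Failure of [avoids] is a strict inequality, hence persists under small moves: the condition
    holds on a whole small ball, or fails around one of its points. *)
Let exists_step i s : K s.1 -> 0 < s.2 -> exists s', step i s s'.
Proof.
case: s => x r /= Kx r0.
have [H|] := pselect (forall z, K z -> `|z - x| <= 2 * (r / 4) -> avoids i z).
  exists (x, r / 4); split => //=; first by rewrite divr_gt0.
    by rewrite subrr normr0; lra.
  by left.
move=> /existsNP[z /not_implyP[Kz /not_implyP[zx]]].
move=> /existsNP[y /existsNP[t /not_implyP[Ky /not_implyP[tw]]]].
move=> /negP; rewrite -ltNge -subr_gt0.
set w := i.2.+1%:R^-1; set g := _ - `|_| => g0.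
(* [g] is the amount by which the inequality fails at [z], and moving by [2 * (g / 4)] does not
   exhaust it; [r / 2] keeps the new ball in the old one. *)
exists (z, Num.min (r / 2) (g / 4)); split => //=.
- by rewrite lt_min !divr_gt0.
- have : Num.min (r / 2) (g / 4) <= r / 2 by rewrite ge_min lexx.
  lra.
right => z' Kz' z'z /(_ y t Ky tw); apply/negP; rewrite -ltNge -/w.
have : Num.min (r / 2) (g / 4) <= g / 4 by rewrite ge_min lexx orbT.
have : `|y - z' - t *: map_mx ratr i.1| <=
    `|z' - z| + `|y - z - t *: map_mx ratr i.1|.
  by rewrite (distrC z'); apply: ler_normD_eq; row_ring.
rewrite /g in g0 *; lra.
Qed.

(** The nested balls shrink to an [x] near which every condition is decided. If [v] is not tangent
    at [x], then [x] avoids a rational cone around [v]; so do the points of [K] near [x], and short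
    secants there cannot approach the direction [v]. *)
Lemma exists_paratingent_sub_tangent : K `&` O !=set0 ->
  exists x, [/\ K x, O x & paratingent_cone K x `<=` secant_cone K 0 x].
Proof.
move=> [a [Ka Oa]].
have /nbhs_ballP[r /= r0 rO] := oO Oa.
have rO' z : `|z - a| <= r / 2 -> O z.
  move=> za; apply: rO; rewrite -ball_normE /= distrC.
  by apply: (le_lt_trans za); lra.
have /choice[next nextH] : forall p : index * ('rV[R]_m * R), exists s',
    K p.2.1 -> 0 < p.2.2 -> step p.1 p.2 s'.
  move=> [i s] /=; have [Ks|nKs] := pselect (K s.1); last by exists s.
  have [s0|ns0] := pselect (0 < s.2); last by exists s.
  by have [s' ss'] := exists_step i Ks s0; exists s'.
(* [idx] meets every condition; numbers coding none of them fall back to [(0, 0)], a harmless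
   repetition. *)
pose idx (n : nat) : index := odflt (0, 0%N) (unpickle n).
pose fix u (n : nat) := if n is n'.+1 then next (idx n', u n') else (a, r / 2).
have uK n : K (u n).1 /\ 0 < (u n).2.
  elim: n => [|n [IH1 IH2]] /=; first by split => //; rewrite divr_gt0.
  by have [] := nextH (idx n, u n) IH1 IH2.
have uS n : step (idx n) (u n) (u n.+1) by exact: nextH (idx n, u n) (uK n).1 (uK n).2.
have uC n j : `|(u (j + n)%N).1 - (u n).1| + (u (j + n)%N).2 <= (u n).2.
  elim: j => [|j IH]; first by rewrite subrr normr0 add0r.
  have [_ _ H _] := uS (j + n)%N; rewrite addSn; apply: le_trans IH.
  apply: (@le_trans _ _ (`|(u (j + n)%N).1 - (u n).1| +
     (`|(u (j + n).+1).1 - (u (j + n)%N).1| + (u (j + n).+1).2))).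
    rewrite addrA lerD2r addrC; apply: ler_normD_eq; row_ring.
  by rewrite lerD2l.
have [x Kx xH] : exists2 w, K w & forall e, 0 < e -> exists w',
    [/\ K w', `|w' - w| < e & exists2 n : nat, n.+1%:R^-1 <= e & w' = (u n).1].
  apply: compact_approx => //.
    by move=> e e' w ee' [n ne ->]; exists n => //; exact: le_trans ee'.
  move=> e e0; have [n _ /(_ n (leqnn _)) /= ne] := near_infty_natSinv_lt (PosNum e0).
  exists (u n).1; first exact: (uK n).1.
  by exists n => //; exact: ltW.
have xu n : `|x - (u n).1| <= (u n).2.
  apply/ler_addgt0Pr => e e0.
  have n0 : 0 < n.+1%:R^-1 :> R by rewrite invr_gt0.
  have en : 0 < Num.min e n.+1%:R^-1 by rewrite lt_min e0.
have [w [Kw wx [j]]] := xH _ en.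
rewrite le_min => /andP[_]; rewrite lef_pV2 ?posrE// ler_nat ltnS => nj wE.
have := uC n (j - n)%N; rewrite subnK// -wE => wu.
have : `|x - (u n).1| <= `|w - x| + `|w - (u n).1|.
  by rewrite (distrC w x); apply: ler_normD_eq; row_ring.
have : Num.min e n.+1%:R^-1 <= e by rewrite ge_min lexx.
have := (uK j).2; lra.
exists x; split => //; first by apply: rO'; exact: (xu 0).
move=> v vP; apply: contrapT => /existsNP[e /not_implyP[e0 vT]].
have {}vT y t : K y -> 0 < t < e -> e * t <= `|y - x - t *: v|.
  move=> Ky te; rewrite leNgt; apply/negP => yt; apply: vT; exists x, y, t.
  by split => //; rewrite subrr normr0 mul0r.
(* Let [w] be [j.+1%:R^-1]. As [w < e / 2] and [q] is within [w / 2] of [v], the cone of opening [w]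
   around [q] lies in that of opening [e] around [v]; another [w / 2] is left for the error of the
   secant. *)
have [j _ /(_ j (leqnn _)) /= je] := near_infty_natSinv_lt (PosNum (divr_gt0 e0 (ltr0n R 2))).
have w0 : (0 : R) < j.+1%:R^-1 by rewrite invr_gt0.
have [q vq] := dense_rat_row v (divr_gt0 w0 (ltr0n R 2)).
pose i : index := (q, j); pose n := pickle i.
have inE : idx n = i by rewrite /idx /n pickleK.
have xF : avoids i x.
  move=> y t Ky /andP[t0 tw]; have {}tw : t < j.+1%:R^-1 := tw.
  change (is_true (j.+1%:R^-1 * t <= `|y - x - t *: map_mx ratr q|)).
  have te : 0 < t < e.
    by rewrite t0 (lt_trans tw)// (lt_trans je)// gtr_pMr// invf_lt1// ltr1n.
  have := vT _ _ Ky te.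
  have : `|y - x - t *: v| <= `|y - x - t *: map_mx ratr q| + t * `|v - map_mx ratr q|.
    rewrite -[X in X * _](gtr0_norm t0) -normrZ -(normrN (t *: (v - _))).
    by apply: ler_normD_eq; row_ring.
  move: (j.+1%:R^-1 : R) w0 je vq tw => w w0 je vq tw; nra.
(* The negative alternative would apply to [x] itself, which avoids the cone. *)
have [_ r10 _ [xA|xA]] := uS n; last first.
  exfalso; apply: (xA x) => //; last by rewrite inE.
  by apply: (le_trans (xu n.+1)); rewrite ler_pMl// ler1n.
set r1 := (u n.+1).2 in r10 xA.
have e20 : 0 < Num.min r1 (j.+1%:R^-1 / 2) by rewrite lt_min r10 divr_gt0.
have [y [z [t [Ky Kz yx /andP[t0 te] zy]]]] := vP _ e20.
have yA : avoids i y.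
  rewrite -inE; apply: xA => //.
  have : `|y - (u n.+1).1| <= `|y - x| + `|x - (u n.+1).1|.
    by apply: ler_normD_eq; row_ring.
  have := xu n.+1; have : Num.min r1 (j.+1%:R^-1 / 2) <= r1 by rewrite ge_min lexx.
  rewrite -/r1; lra.
have : 0 < t < j.+1%:R^-1 ->
  j.+1%:R^-1 * t <= `|z - y - t *: map_mx ratr q| by exact: yA.
rewrite t0 /=.
have : Num.min r1 (j.+1%:R^-1 / 2) <= j.+1%:R^-1 / 2 by rewrite ge_min lexx orbT.
have : `|z - y - t *: map_mx ratr q| <= `|z - y - t *: v| + t * `|v - map_mx ratr q|.
  rewrite -[X in X * _](gtr0_norm t0) -normrZ.
  by apply: ler_normD_eq; row_ring.
move: (j.+1%:R^-1 : R) (Num.min _ _) w0 je vq te zy => w e1 w0 je vq te zy h1 h2.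
have tw : t < w by lra.
move=> /(_ tw); nra.
Qed.

End Choquet.

(** * Lipschitz graphs *)

Section LipschitzGraph.
Variables (R : realType) (m : nat) (K : set 'rV[R]_m).

(** The upper bound is automatic for a linear [Q]. With this lower bound, [Q] is injective on [K]
    near [x] with an [L]-Lipschitz inverse: [K] is there a Lipschitz graph over its projection. *)
Definition bilipschitz_near p (Q : 'M[R]_(m, p)) x L r :=
  forall y z, K y -> K z -> `|y - x| < r -> `|z - x| < r ->
    `|z - y| <= L * `|(z - y) *m Q|.

(** Secants in a direction killed by [Q] have projections [o(t)], hence are themselves [o(t)]. *)
Lemma bilipschitz_near_tangent p (Q : 'M[R]_(m, p)) x L r y v :
  0 <= L -> bilipschitz_near Q x L r -> `|y - x| < r ->
  secant_cone K 0 y v -> v *m Q = 0 -> v = 0.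
Proof.
move=> L0 QL yx vT vQ; apply/eqP; rewrite -normr_le0.
have b0 := mx_bound_gt0 Q; set b := mx_bound Q in b0.
pose c := L * b + 1.
have c0 : 0 < c by rewrite ltr_wpDl// mulr_ge0// ltW.
apply/ler_addgt0Pr => e e0; rewrite add0r.
pose e1 := Num.min (e / c) (Num.min 1 ((r - `|y - x|) / (`|v| + 1))).
have v1 : 0 < `|v| + 1 by rewrite ltr_wpDl.
have e10 : 0 < e1 by rewrite !lt_min ltr01 !divr_gt0// subr_gt0.
have e11 : e1 <= 1 by rewrite !ge_min lexx !orbT.
have e1e : c * e1 <= e by rewrite mulrC -ler_pdivlMr// !ge_min lexx.
have e1r : (`|v| + 1) * e1 <= r - `|y - x|.
  by rewrite mulrC -ler_pdivlMr// !ge_min lexx !orbT.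
have [y' [z [t [Ky Kz]]]] := vT _ e10; rewrite mul0r normr_le0 subr_eq0.
move=> /eqP yE; rewrite yE in Ky *; move=> /andP[t0 te] zy.
have zy1 : `|z - y| <= `|z - y - t *: v| + t * `|v|.
  rewrite -[X in X * _](gtr0_norm t0) -normrZ; apply: ler_normD_eq; row_ring.
have zx : `|z - x| < r.
  have : `|z - x| <= `|z - y| + `|y - x| by apply: ler_normD_eq; row_ring.
  nra.
have := QL y z Ky Kz yx zx.
have -> : (z - y) *m Q = (z - y - t *: v) *m Q.
  by rewrite [in RHS]mulmxBl -scalemxAl vQ scaler0 subr0.
have h1 := normr_mulmx_le (z - y - t *: v) Q; rewrite -/b in h1 => h2.
have h3 : t * `|v| <= `|z - y - t *: v| + `|z - y|.
  rewrite -[X in X * _](gtr0_norm t0) -normrZ -(normrN (z - y - _)).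
  by apply: ler_normD_eq; row_ring.
have h4 : L * `|(z - y - t *: v) *m Q| <= L * (b * `|z - y - t *: v|).
  by rewrite ler_wpM2l.
rewrite -(ler_pM2l t0).
have h5 : c * `|z - y - t *: v| <= c * (e1 * t) by rewrite ler_pM2l// ltW.
have h6 : (c * e1) * t <= e * t by rewrite ler_pM2r.
rewrite /c in h5 h6; lra.
Qed.

(** If every constant failed near [x], unit secants with projections tending to 0 would cluster at a
    paratingent vector in the kernel of [Q]. *)
Lemma bilipschitz_near_of_paratingent p (Q : 'M[R]_(m, p)) x :
  (forall v, paratingent_cone K x v -> v *m Q = 0 -> v = 0) ->
  exists L r, [/\ 0 < L, 0 < r & bilipschitz_near Q x L r].
Proof.
move=> PQ; apply: contrapT => H.
pose S e (w : 'rV[R]_m) := `|w| = 1 /\ exists y z t, [/\ K y, K z, `|y - x| < e, 0 < t < e &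
  z - y = t *: w /\ `|w *m Q| <= e].
have [w0 _ w0H] : exists2 w, `|w - 0| <= 1 & forall e, 0 < e -> exists w',
    [/\ `|w' - 0| <= 1, `|w' - w| < e & S e w'].
  apply: (@compact_approx _ _ [set w : 'rV[R]_m | `|w - 0| <= 1] S).
  - exact: closed_ball_rV_compact.
  - move=> e e' w ee' [w1 [y [z [t [Ky Kz yx /andP[t0 te] [zy wQ]]]]]].
    split=> //; exists y, z, t; split => //; first exact: lt_le_trans ee'.
      by rewrite t0 (lt_le_trans te).
    by split => //; exact: le_trans ee'.
  move=> e e0; apply: contrapT => nS; apply: H.
  (* Radius [e / 2] makes the secant shorter than [e]; failure of the constant [e^-1] makes its unit
     direction project below [e]. *)
  exists e^-1, (e / 2); split; [by rewrite invr_gt0|by rewrite divr_gt0|].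
  move=> y z Ky Kz yx zx; rewrite leNgt; apply/negP => zyQ.
  have zy0 : 0 < `|z - y|.
    rewrite normr_gt0; apply: contraTneq zyQ => ->.
    by rewrite mul0mx !normr0 mulr0 ltxx.
  apply: nS; exists (`|z - y|^-1 *: (z - y)).
    by rewrite /= subr0 normrZ normfV normr_id mulVf// gt_eqF.
  split; first by rewrite normrZ normfV normr_id mulVf// gt_eqF.
  exists y, z, `|z - y|; split => //.
  - by apply: (lt_trans yx); lra.
  - rewrite zy0 /=; have : `|z - y| <= `|z - x| + `|y - x|.
      by rewrite (distrC y); apply: ler_normD_eq; row_ring.
    lra.
  split; first by rewrite scalerA divff ?scale1r// gt_eqF.
  rewrite -scalemxAl normrZ normfV normr_id mulrC ler_pdivrMr//.
  by rewrite -ler_pdivrMl//; exact: ltW.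
have w00 : w0 = 0.
  apply: PQ.
    move=> e e0; have [w [_ ww0 [_ [y [z [t [Ky Kz yx /andP[t0 te] [zy _]]]]]]]] := w0H e e0.
    exists y, z, t; split => //; first by rewrite t0.
    by rewrite zy -scalerBr normrZ (gtr0_norm t0) mulrC ltr_pM2r.
  apply/eqP; rewrite -normr_le0; apply/ler_addgt0Pr => e e0; rewrite add0r.
  have b0 := mx_bound_gt0 Q; set b := mx_bound Q in b0.
  have b1 : 0 < b + 1 by rewrite addr_gt0.
  have [w [_ ww0 [_ [y [z [t [_ _ _ _ [_ wQ]]]]]]]] := w0H (e / (b + 1)) ltac:(by rewrite divr_gt0).
  have : `|w0 *m Q| <= `|w *m Q| + `|(w - w0) *m Q|.
    rewrite -(normrN ((w - w0) *m Q)) mulmxBl; apply: ler_normD_eq.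
    by rewrite opprB addrC subrK.
  have := normr_mulmx_le (w - w0) Q; rewrite -/b.
  have : b * `|w - w0| <= b * (e / (b + 1)) by rewrite ler_pM2l// ltW.
  have : e / (b + 1) * (b + 1) = e by rewrite mulfVK// gt_eqF.
  lra.
(* A limit of unit vectors cannot be zero. *)
have [w [_ ww0 [w1 _]]] := w0H 1 ltr01.
by move: ww0; rewrite w00 subr0 w1 ltxx.
Qed.

End LipschitzGraph.

(** * Tangent cones of homogeneous sets *)

Section Homogeneous.
Variables (R : realType) (m : nat) (K O : set 'rV[R]_m).
Hypotheses (cK : compact K) (oO : open O) (KO : K `&` O !=set0).

Definition locally_homogeneous := forall x y, K x -> O x -> K y -> O y ->
  exists f A g B, [/\ local_map K x y f A, local_map K y x g B,
    A *m B = 1%:M & B *m A = 1%:M].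

Hypothesis hom : locally_homogeneous.

(** The vector is carried to a Choquet point [x0], where being paratingent implies being tangent,
    and carried back by [B], the inverse of [A]. *)
Lemma secant_cone_tangent x C v : K x -> O x -> 0 <= C ->
  secant_cone K C x v -> secant_cone K 0 x v.
Proof.
move=> Kx Ox C0 vC.
have [x0 [Kx0 Ox0 x0T]] := exists_paratingent_sub_tangent cK oO KO.
have [f [A [g [B [fA gB AB BA]]]]] := hom Kx Ox Kx0 Ox0.
have /secant_cone_paratingent/x0T := secant_cone_map C0 fA vC.
move=> /(secant_cone_map (lexx 0) gB).
by rewrite mulr0 -mulmxA AB mulmx1.
Qed.

Lemma tangentN x v : K x -> O x ->
  secant_cone K 0 x v -> secant_cone K 0 x (- v).
Proof.
move=> Kx Ox vT; have := secant_coneN (lexx 0) vT.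
by apply: secant_cone_tangent => //; rewrite add0r addr_ge0.
Qed.

End Homogeneous.

Section LipschitzGraphOverBall.
Variables (R : realType) (m : nat) (K O : set 'rV[R]_m).
Hypotheses (cK : compact K) (oO : open O) (KO : K `&` O !=set0).
Hypothesis hom : locally_homogeneous K O.

(* The ball around [b] through [y *m Q] misses the projection of [K] near [y];
   being convex, it contains the directions from [y *m Q] towards [b]. *)
Lemma tangent_of_nearest_projection p (Q : 'M[R]_(m, p)) x L r y b v s :
  0 <= L -> bilipschitz_near K Q x L r -> K y -> O y ->
  (exists2 d, 0 < d & forall z, K z -> `|z - y| < d -> `|y *m Q - b| <= `|z *m Q - b|) ->
  `|y - x| < r -> b <> y *m Q ->
  secant_cone K 0 y v -> v *m Q = s *: (b - y *m Q) -> v = 0.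
Proof.
move=> L0 QL Ky Oy [d d0 yb] yx byQ.
(* Symmetry of the tangent cone allows [v] to project towards [b]. *)
wlog s0 : s v / 0 <= s => [H|] vT vQ.
  have [/H|s0] := leP 0 s; first exact.
  apply/eqP; rewrite -oppr_eq0; apply/eqP; apply: (H (- s)).
  - by rewrite oppr_ge0 ltW.
  - exact: (tangentN cK oO KO hom).
  - by rewrite mulNmx vQ scaleNr.
have [s00|sn0] := eqVneq s 0.
  apply: (bilipschitz_near_tangent L0 QL yx vT).
  by rewrite vQ s00 scale0r.
have {sn0}s0 : 0 < s by rewrite lt_neqAle eq_sym sn0.
exfalso; set u := b - y *m Q in vQ.
have u0 : 0 < `|u| by rewrite normr_gt0 subr_eq0; apply/eqP.
have c0 := mx_bound_gt0 Q; set c := mx_bound Q in c0.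
have v1 : 0 < `|v| + 1 by rewrite ltr_wpDl.
pose e := Num.min (Num.min 1 (s * `|u| / (2 * c))) (Num.min s^-1 (d / (`|v| + 1))).
have e0 : 0 < e by rewrite !lt_min ltr01 invr_gt0 s0 !divr_gt0 ?mulr_gt0.
have e1 : e <= 1 by rewrite !ge_min lexx.
have ec : 2 * c * e <= s * `|u|.
  by rewrite mulrC -ler_pdivlMr ?mulr_gt0// !ge_min lexx !orbT.
have es : s * e <= 1.
  by rewrite mulrC -ler_pdivlMr// mul1r !ge_min lexx !orbT.
have ed : (`|v| + 1) * e <= d.
  by rewrite mulrC -ler_pdivlMr// !ge_min lexx !orbT.
have [y' [z [t [_ Kz]]]] := vT _ e0; rewrite mul0r normr_le0 subr_eq0.
move=> /eqP-> /andP[t0 te] zy.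
have zd : `|z - y| < d.
  have : `|z - y| <= `|z - y - t *: v| + t * `|v|.
    rewrite -[X in X * _](gtr0_norm t0) -normrZ; apply: ler_normD_eq; row_ring.
  nra.
have := yb z Kz zd; rewrite distrC -/u => uz.
have h1 := normr_mulmx_le (z - y - t *: v) Q; rewrite -/c in h1.
have st : s * t <= 1 by apply: le_trans es; rewrite ler_pM2l// ltW.
(* Along [v] the distance to [b] drops by [s * t] times the norm of [u], and the choice of [e]
   limits the error to half of that, against the minimality in [uz]. *)
have h2 : `|z *m Q - b| <= `|(z - y - t *: v) *m Q| + (1 - s * t) * `|u|.
  rewrite -[X in X * `|u|](ger0_norm (_ : 0 <= 1 - s * t)) ?subr_ge0//.
  rewrite -normrZ -(normrN ((1 - s * t) *: u)); apply: ler_normD_eq.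
  rewrite !mulmxBl -scalemxAl vQ /u.
  by move: (z *m Q) (y *m Q) => zQ yQ; row_ring.
have h3 : c * `|z - y - t *: v| <= c * (e * t) by rewrite ler_pM2l// ltW.
have h4 : 2 * c * e * t <= s * `|u| * t by rewrite ler_pM2r.
have h5 : 0 < s * `|u| * t by rewrite !mulr_gt0.
lra.
Qed.

(** [col_base (cokermx u)] is the projection modulo the line of [u]; composing with it is what
    lowers the dimension of a graph. *)
Lemma cokermx_base_kernel p (u : 'rV[R]_p) (w : 'rV[R]_p) :
  w *m col_base (cokermx u) = 0 -> exists s, w = s *: u.
Proof.
move=> w0; have : (w <= u)%MS.
  by rewrite submxE -(mulmx_base (cokermx u)) mulmxA w0 mul0mx.
by move=> /submxP[D ->]; exists (D 0 0); rewrite [in LHS](mx11_scalar D) mul_scalar_mx.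
Qed.

Let graph_dim (k : nat) := exists (Q : 'M[R]_(m, k)) x L r,
  [/\ K x, O x, 0 < L, 0 < r & bilipschitz_near K Q x L r].

Lemma exists_lipschitz_graph_over_ball : exists2 k : nat, (k <= m)%N &
  exists (Q : 'M[R]_(m, k)) x L r b0 rho,
  [/\ 0 < L, bilipschitz_near K Q x L r, 0 < rho,
      (forall y, `|y - x| < r -> O y) &
      forall b, `|b - b0| < rho -> exists y, [/\ K y, `|y - x| < r & y *m Q = b]].
Proof.
have dim_m : graph_dim m.
  have [x [Kx Ox]] := KO; exists 1%:M, x, 1, 1; split => // y z _ _ _ _.
  by rewrite mulmx1 mul1r.
pose P k := `[< graph_dim k >].
have exP : exists k, P k by exists m; apply/asboolP.
case: (ex_minnP exP) => k /asboolP[Q [x [L [r0 [Kx Ox L0 r00 QL0]]]]] kmin.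
exists k; first by apply: kmin; apply/asboolP.
have /nbhs_ballP[r1 /= r10 r1O] := oO Ox.
pose r := Num.min r0 r1.
have r_gt0 : 0 < r by rewrite lt_min r00.
have rO y : `|y - x| < r -> O y.
  move=> yr; apply: r1O; rewrite -ball_normE /= distrC (lt_le_trans yr)//.
  by rewrite ge_min lexx orbT.
have QL : bilipschitz_near K Q x L r.
  have rr : r <= r0 by rewrite ge_min lexx.
  by move=> y z Ky Kz yr zr; apply: QL0 => //; exact: lt_le_trans rr.
(* With this radius, a [y] in [K1] whose projection is nearest to [b] projects within [r / (2 * L)]
   of [x *m Q]. So [y] is at distance less than [r / 2] from [x], and the minimum over [K1] is a
   local minimum over [K]. *)
exists Q, x, L, r, (x *m Q), (r / (4 * L)).
have rho0 : 0 < r / (4 * L) by rewrite divr_gt0// mulr_gt0.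
split => // b bx; apply: contrapT => nb.
pose K1 := K `&` [set y | `|y - x| <= r / 2].
have cK1 : compact K1.
  apply: compact_closedI => //; apply: compact_closed.
    exact: norm_hausdorff.
  exact: closed_ball_rV_compact.
have K1x : K1 x by split => //=; rewrite subrr normr0 divr_ge0// ltW.
have [y /set_mem[Ky yx] ymin] : exists2 y, y \in K1 &
    forall z, z \in K1 -> `|y *m Q - b| <= `|z *m Q - b|.
  apply: (EVT_min_rV (f := fun z => `|z *m Q - b|)).
  - by exists x.
  - exact: cK1.
  apply: continuous_subspaceT => z.
  apply: (@continuous_comp _ _ _ (fun z : 'rV[R]_m => z *m Q - b) (fun w => `|w|)).
    apply: (@continuousB _ _ _ (fun z : 'rV[R]_m => z *m Q)).
      exact: mulmx_continuous.
    exact: cst_continuous.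
  exact: norm_continuous.
have yxlt : `|y - x| < r / 2.
  have h1 : `|y *m Q - b| < r / (4 * L).
    apply: le_lt_trans bx; rewrite [leRHS]distrC; apply: ymin; exact: mem_set.
  have h2 : `|(y - x) *m Q| <= `|y *m Q - b| + `|b - x *m Q|.
    rewrite mulmxBl; apply: ler_normD_eq.
    by move: (y *m Q) (x *m Q) => p q; row_ring.
  have yr : `|y - x| < r by move: yx => /= yx; lra.
  have xr : `|x - x| < r by rewrite subrr normr0.
  have h3 := QL x y Kx Ky xr yr.
  have h4 : L * `|(y - x) *m Q| < L * (r / (4 * L) + r / (4 * L)).
    by rewrite ltr_pM2l//; lra.
  have h5 : L * (r / (4 * L) + r / (4 * L)) = r / 2.
    by field; rewrite gt_eqF.
  by rewrite -h5; exact: le_lt_trans h4.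
have yr : `|y - x| < r by lra.
have byQ : b <> y *m Q by move=> bE; apply: nb; exists y.
have yloc : exists2 d, 0 < d & forall z, K z -> `|z - y| < d ->
    `|y *m Q - b| <= `|z *m Q - b|.
  exists (r / 2 - `|y - x|); first by rewrite subr_gt0.
  move=> z Kz zy; apply: ymin; apply: mem_set; split => //=.
  have : `|z - x| <= `|z - y| + `|y - x| by apply: ler_normD_eq; row_ring.
  lra.
have Oy := rO y yr.
have yT v s := tangent_of_nearest_projection (v := v) (s := s) (ltW L0) QL Ky Oy yloc yr byQ.
set u := b - y *m Q in yT.
have [x0 [Kx0 Ox0 x0T]] := exists_paratingent_sub_tangent cK oO KO.
have [f [A [g [B [fA gB AB BA]]]]] := hom Ky Oy Kx0 Ox0.
(* A paratingent vector at [x0] killed by the composite is tangent; transported to [y] it projects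
   into the line of [u], where it must vanish. *)
have [L' [r' [L'0 r'0 QL']]] : exists L r, [/\ 0 < L, 0 < r &
    bilipschitz_near K (B *m Q *m col_base (cokermx u)) x0 L r].
  apply: bilipschitz_near_of_paratingent => v /x0T vT.
  rewrite mulmxA => vC; have [s vs] := cokermx_base_kernel vC.
  rewrite mulmxA in vs.
  have := secant_cone_map (lexx 0) gB vT; rewrite mulr0 => vBT.
  by rewrite -(mulmx1 v) -BA mulmxA (yT _ _ vBT vs) mul0mx.
have /kmin : P (\rank (cokermx u)).
  by apply/asboolP; exists (B *m Q *m col_base (cokermx u)), x0, L', r'.
have u0 : u != 0 by rewrite subr_eq0; apply/eqP.
rewrite mxrank_coker rank_rV u0 leqNgt subn1 ltn_predL.
(* For [k = 0], where the predecessor is not smaller, [u] would have no entries and be zero. *)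
by case: (k) u u0 {yT QL'} => // u; rewrite thinmx0 eqxx.
Qed.

End LipschitzGraphOverBall.

(** * Differentiability of the graph *)

Section Clamp.
Variables (R : realType) (k : nat) (b0 : 'rV[R]_k) (s : R).
Hypothesis s0 : 0 <= s.

(** A coordinatewise, hence 1-Lipschitz, retraction onto the closed sup-norm ball; it serves to
    extend [F] to the whole space. *)
Definition clamp_row (b : 'rV[R]_k) : 'rV[R]_k :=
  \row_i (b0 ord0 i + Num.max (- s) (Num.min s (b ord0 i - b0 ord0 i))).

Lemma clamp_row_bound b : `|clamp_row b - b0| <= s.
Proof.
apply: normr_row_le => // i; rewrite !mxE addrAC subrr add0r ler_norml.
apply/andP; split; first by rewrite le_max lexx.
by rewrite ge_max ge_min lexx andbT (le_trans _ s0)// oppr_le0.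
Qed.

Lemma clamp_row_id b : `|b - b0| <= s -> clamp_row b = b.
Proof.
move=> bs; apply/rowP => i; rewrite !mxE.
have := le_trans (le_normr_coord (b - b0) i) bs; rewrite !mxE ler_norml => /andP[h1 h2].
by rewrite min_r// max_r// addrC subrK.
Qed.

Lemma clamp_row_lipschitz b b' : `|clamp_row b - clamp_row b'| <= `|b - b'|.
Proof.
apply: normr_row_le => // i; apply: le_trans (le_normr_coord (b - b') i).
rewrite !mxE opprD addrACA subrr add0r.
set p := b ord0 i; set q := b' ord0 i; set c := b0 ord0 i.
have -> : p - q = (p - c) - (q - c) by ring.
move: (p - c) (q - c) => {p q c} p q; rewrite /Num.max /Num.min.
wlog pq : p q / q <= p => [H|].
  have [/H//|/ltW/H] := leP q p; by rewrite distrC (distrC p).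
rewrite [leRHS]ger0_norm ?subr_ge0// ler_norml.
by repeat case: ifPn => //; rewrite -?leNgt => *; lra.
Qed.

End Clamp.

Section DifferentiableGraph.
Variables (R : realType) (m k : nat) (K O : set 'rV[R]_m).
Hypotheses (cK : compact K) (oO : open O) (KO : K `&` O !=set0).
Hypothesis hom : locally_homogeneous K O.
Variables (Q : 'M[R]_(m, k)) (x : 'rV[R]_m) (L r : R) (b0 : 'rV[R]_k) (rho : R).
Hypotheses (L0 : 0 < L) (QL : bilipschitz_near K Q x L r) (rho0 : 0 < rho).
Hypothesis rO : forall y, `|y - x| < r -> O y.
Variable F : 'rV[R]_k -> 'rV[R]_m.
Hypothesis FK : forall b, `|b - b0| < rho ->
  [/\ K (F b), `|F b - x| < r & F b *m Q = b].

Lemma graph_eq z : K z -> `|z - x| < r -> `|z *m Q - b0| < rho ->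
  F (z *m Q) = z.
Proof.
move=> Kz zx /FK[KF Fx FQ].
have := QL Kz KF zx Fx; rewrite mulmxBl FQ subrr normr0 mulr0 normr_le0 subr_eq0.
by move=> /eqP.
Qed.

Lemma graph_lipschitz b b' : `|b - b0| < rho -> `|b' - b0| < rho ->
  `|F b - F b'| <= L * `|b - b'|.
Proof.
move=> /FK[Kb bx bQ] /FK[Kb' bx' bQ'].
by have := QL Kb' Kb bx' bx; rewrite mulmxBl bQ bQ'.
Qed.

(** * The tangent cone at a point with partial derivatives *)

Section PartialDerivativePoint.
Variables (b1 : 'rV[R]_k) (D : 'M[R]_(k, m)).
Hypothesis b1rho : `|b1 - b0| < rho.
Hypothesis FD : forall i e, 0 < e -> exists2 d, 0 < d & forall t, `|t| < d ->
  `|F (b1 + t *: delta_mx ord0 i) - F b1 - t *: row i D| <= e * `|t|.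

Let x1 := F b1.

Let Kx1 : K x1. Proof. by have [] := FK b1rho. Qed.
Let x1x : `|x1 - x| < r. Proof. by have [] := FK b1rho. Qed.
Let x1Q : x1 *m Q = b1. Proof. by have [] := FK b1rho. Qed.
Let Ox1 : O x1. Proof. exact: rO. Qed.

Let near_graph : exists2 d, 0 < d & forall z, K z -> `|z - x1| < d ->
  `|z *m Q - b0| < rho /\ F (z *m Q) = z.
Proof.
have c0 := mx_bound_gt0 Q; set c := mx_bound Q in c0.
exists (Num.min (r - `|x1 - x|) ((rho - `|b1 - b0|) / c)).
  by rewrite lt_min subr_gt0 x1x divr_gt0// subr_gt0.
move=> z Kz; rewrite lt_min ltr_pdivlMr// => /andP[zx zQ].
have zx' : `|z - x| < r.
  have : `|z - x| <= `|z - x1| + `|x1 - x| by apply: ler_normD_eq; row_ring.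
  lra.
have zb : `|z *m Q - b0| < rho.
  have : `|z *m Q - b0| <= `|(z - x1) *m Q| + `|b1 - b0|.
    by apply: ler_normD_eq; rewrite mulmxBl x1Q; move: (z *m Q) => zQ'; row_ring.
  have := normr_mulmx_le (z - x1) Q; rewrite -/c; lra.
by split=> //; exact: graph_eq.
Qed.

Let near_b1 i s : exists2 d, 0 < d & forall t, 0 < t < d ->
  `|b1 + (t * s) *: delta_mx ord0 i - b0| < rho.
Proof.
have s1 : 0 < `|s| + 1 by rewrite ltr_wpDl.
exists ((rho - `|b1 - b0|) / (`|s| + 1)); first by rewrite divr_gt0// subr_gt0.
move=> t /andP[t0]; rewrite ltr_pdivlMr// => tr.
have : `|b1 + (t * s) *: delta_mx ord0 i - b0| <= `|(t * s) *: (delta_mx ord0 i : 'rV[R]_k)| + `|b1 - b0|.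
  by apply: ler_normD_eq; row_ring.
rewrite normrZ normr_delta_row mulr1 normrM (gtr0_norm t0) => H.
have : t * `|s| < t * (`|s| + 1) by rewrite ltr_pM2l// ltrDl.
lra.
Qed.

(** A point [z] of the graph reached along [w] projects to within [o(t)] of the axis, so by the
    Lipschitz bound it is [o(t)] away from the graph point over the axis, which the partial
    derivative locates. *)
Let tangent_over_axis i s w : secant_cone K 0 x1 w ->
  w *m Q = s *: delta_mx ord0 i -> w = s *: row i D.
Proof.
move=> wT wQ; apply/eqP; rewrite -subr_eq0 -normr_le0.
apply/ler_addgt0Pr => e e0; rewrite add0r.
have c0 := mx_bound_gt0 Q; set c := mx_bound Q in c0.
(* Three errors: the secant itself, its projection seen through [F], and the partial derivative. *)
pose a := 1 + L * c + `|s|.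
have a0 : 0 < a by rewrite ltr_wpDr// addr_gt0// mulr_gt0.
have ea0 : 0 < e / a by rewrite divr_gt0.
have [d1 d10 H1] := FD i ea0.
have [d2 d20 H2] := near_graph.
have [d3 d30 H3] := near_b1 i s.
have s1 : 0 < `|s| + 1 by rewrite ltr_wpDl.
have w1 : 0 < `|w| + 1 by rewrite ltr_wpDl.
pose e1 := Num.min (Num.min 1 (e / a)) (Num.min (d1 / (`|s| + 1)) (Num.min (d2 / (`|w| + 1)) d3)).
have e10 : 0 < e1 by rewrite !lt_min ltr01 ea0 !divr_gt0.
have e11 : e1 <= 1 by rewrite !ge_min lexx.
have e1e : e1 <= e / a by rewrite !ge_min lexx !orbT.
have e1s : (`|s| + 1) * e1 <= d1.
  by rewrite mulrC -ler_pdivlMr// !ge_min lexx !orbT.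
have e1w : (`|w| + 1) * e1 <= d2.
  by rewrite mulrC -ler_pdivlMr// !ge_min lexx !orbT.
have e13 : e1 <= d3 by rewrite !ge_min lexx !orbT.
have [y' [z [t [_ Kz]]]] := wT _ e10; rewrite mul0r normr_le0 subr_eq0.
move=> /eqP-> /andP[t0 te] zx.
have zd2 : `|z - x1| < d2.
  have : `|z - x1| <= `|z - x1 - t *: w| + t * `|w|.
    rewrite -[X in X * _](gtr0_norm t0) -normrZ; apply: ler_normD_eq; row_ring.
  nra.
have [zb zF] := H2 z Kz zd2.
have tb := H3 t ltac:(by rewrite t0 (lt_le_trans te)).
have h1 := graph_lipschitz zb tb; rewrite zF in h1.
have h2 : `|z *m Q - (b1 + (t * s) *: delta_mx ord0 i)| <= c * (e / a * t).
  rewrite (_ : _ - _ = (z - x1 - t *: w) *m Q); last first.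
    by rewrite !mulmxBl -scalemxAl x1Q wQ scalerA opprD addrA.
  apply: (le_trans (normr_mulmx_le _ _)); rewrite -/c ler_pM2l//.
  by apply/ltW/(lt_le_trans zx); rewrite ler_pM2r.
have ts : `|t * s| < d1 by rewrite normrM (gtr0_norm t0); nra.
have h3 := H1 _ ts; rewrite normrM (gtr0_norm t0) in h3.
have h4 : t * `|w - s *: row i D| <= `|z - x1 - t *: w| +
    (`|z - F (b1 + (t * s) *: delta_mx ord0 i)| +
     `|F (b1 + (t * s) *: delta_mx ord0 i) - x1 - (t * s) *: row i D|).
  rewrite -[X in X * _](gtr0_norm t0) -normrZ.
  apply: (@le_trans _ _ (`|z - x1 - t *: w| +
    `|z - F (b1 + (t * s) *: delta_mx ord0 i) +
     (F (b1 + (t * s) *: delta_mx ord0 i) - x1 - (t * s) *: row i D)|)).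
    rewrite -(normrN (z - x1 - _)); apply: ler_normD_eq.
    by move: (F _) x1 (row i D) => y x' v; row_ring.
  by rewrite lerD2l ler_normD.
rewrite -(ler_pM2l t0).
have h5 : L * `|z *m Q - (b1 + (t * s) *: delta_mx ord0 i)| <= L * (c * (e / a * t)).
  by rewrite ler_pM2l.
have h6 : `|z - x1 - t *: w| <= e / a * t.
  by apply/ltW/(lt_le_trans zx); rewrite ler_pM2r.
have h7 : (e / a * t) * a = t * e by rewrite mulrAC mulfVK ?gt_eqF// mulrC.
move: h7; rewrite /a; nra.
Qed.

(** The end [z] of a secant along [w] is moved on the graph to the [z'] whose projection is shifted
    by [t * s] along axis [i]. The quotients of [z' - z] by [t] are bounded and cluster at [om0];
    once [om0] is known to be tangent, [tangent_over_axis] identifies it. *)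
Let tangent_add_axis i s w : secant_cone K 0 x1 w ->
  secant_cone K 0 x1 (w + s *: row i D).
Proof.
move=> wT; have c0 := mx_bound_gt0 Q; set c := mx_bound Q in c0.
pose S e (om : 'rV[R]_m) := exists z z' t,
  [/\ K z, K z', 0 < t < e, `|z - x1 - t *: w| < e * t &
   z' - z = t *: om /\ om *m Q = s *: delta_mx ord0 i].
have [om0 _ omH] : exists2 om0, `|om0 - 0| <= L * `|s| & forall e, 0 < e ->
    exists om, [/\ `|om - 0| <= L * `|s|, `|om - om0| < e & S e om].
  apply: (@compact_approx _ _ [set v : 'rV[R]_m | `|v - 0| <= L * `|s|] S).
  - exact: closed_ball_rV_compact.
  - move=> e e' om ee' [z [z' [t [Kz Kz' /andP[t0 te] zx H]]]].
    exists z, z', t; split => //; first by rewrite t0 (lt_le_trans te).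
    by apply: (lt_le_trans zx); rewrite ler_pM2r.
  move=> e e0; have [d d0 near_x1] := near_graph.
  have w1 : 0 < `|w| + 1 by rewrite ltr_wpDl.
  have a0 : 0 < c * (`|w| + 1) + `|s| by rewrite ltr_wpDr// mulr_gt0.
  have rb : 0 < rho - `|b1 - b0| by rewrite subr_gt0.
  pose e1 := Num.min (Num.min 1 e) (Num.min (d / (`|w| + 1))
    ((rho - `|b1 - b0|) / (c * (`|w| + 1) + `|s|))).
  have e10 : 0 < e1 by rewrite !lt_min ltr01 e0 !divr_gt0.
  have e11 : e1 <= 1 by rewrite !ge_min lexx.
  have e1e : e1 <= e by rewrite !ge_min lexx !orbT.
  have e1w : (`|w| + 1) * e1 <= d.
    by rewrite mulrC -ler_pdivlMr// !ge_min lexx !orbT.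
  have e1a : (c * (`|w| + 1) + `|s|) * e1 <= rho - `|b1 - b0|.
    by rewrite mulrC -ler_pdivlMr// !ge_min lexx !orbT.
  have [y' [z [t [_ Kz]]]] := wT _ e10; rewrite mul0r normr_le0 subr_eq0.
  move=> /eqP-> /andP[t0 te] zx.
  have zx' : `|z - x1| <= (`|w| + 1) * t.
    have : `|z - x1| <= `|z - x1 - t *: w| + t * `|w|.
      rewrite -[X in X * _](gtr0_norm t0) -normrZ; apply: ler_normD_eq; row_ring.
    nra.
  have zd : `|z - x1| < d.
    by apply: (le_lt_trans zx'); apply: lt_le_trans e1w; rewrite ltr_pM2l.
  have [zb zF] := near_x1 z Kz zd.
  pose b' := z *m Q + (t * s) *: delta_mx ord0 i.
  have nts : `|(t * s) *: (delta_mx ord0 i : 'rV[R]_k)| = t * `|s|.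
    by rewrite normrZ normr_delta_row mulr1 normrM (gtr0_norm t0).
  have b'b : `|b' - b0| < rho.
    have h1 : `|b' - b0| <= `|(z - x1) *m Q| + (t * `|s| + `|b1 - b0|).
      apply: (@le_trans _ _ (`|(z - x1) *m Q| +
         `|(t * s) *: delta_mx ord0 i + (b1 - b0)|)).
        apply: ler_normD_eq; rewrite mulmxBl x1Q /b'.
        by move: (z *m Q) => p; row_ring.
      by rewrite lerD2l -nts ler_normD.
    have h2 := normr_mulmx_le (z - x1) Q; rewrite -/c in h2.
    have h3 : c * `|z - x1| <= c * ((`|w| + 1) * t) by rewrite ler_pM2l.
    have h4 : (c * (`|w| + 1) + `|s|) * t < rho - `|b1 - b0|.
      by apply: lt_le_trans e1a; rewrite ltr_pM2l.
    lra.
  have [Kz' _ z'Q] := FK b'b.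
  exists (t^-1 *: (F b' - z)).
    rewrite /= subr0 normrZ normfV (gtr0_norm t0) mulrC ler_pdivrMr//.
    have := graph_lipschitz b'b zb.
    by rewrite zF /b' (addrC (z *m Q)) addrK nts [t * `|s|]mulrC mulrA.
  exists z, (F b'), t; split => //.
  - by rewrite t0 (lt_le_trans te).
  - by apply: (lt_le_trans zx); rewrite ler_pM2r.
  split; first by rewrite scalerA divff ?scale1r// gt_eqF.
  rewrite -scalemxAl mulmxBl z'Q /b' (addrC (z *m Q)) addrK scalerA mulrA mulVf ?mul1r//.
  by rewrite gt_eqF.
(* The secants from [z] to [z'] have their base at distance [O(t)] from [x1]: homogeneity makes
   their limit tangent. *)
have om0T : secant_cone K 0 x1 om0.
  apply: (secant_cone_tangent cK oO KO hom (C := `|w| + 1)) => //.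
  move=> e e0.
  have e10 : 0 < Num.min 1 e by rewrite lt_min ltr01.
  have [om [_ om_om0 [z [z' [t [Kz Kz' /andP[t0 te] zx [z'z _]]]]]]] := omH _ e10.
  have e11 : Num.min 1 e <= 1 by rewrite ge_min lexx.
  have e1e : Num.min 1 e <= e by rewrite ge_min lexx orbT.
  exists z, z', t; split => //.
  - have : `|z - x1| <= `|z - x1 - t *: w| + t * `|w|.
      rewrite -[X in X * _](gtr0_norm t0) -normrZ; apply: ler_normD_eq; row_ring.
    nra.
  - by rewrite t0 (lt_le_trans te).
  rewrite z'z -scalerBr normrZ (gtr0_norm t0) mulrC ltr_pM2r//.
  exact: lt_le_trans e1e.
have om0Q : om0 *m Q = s *: delta_mx ord0 i.
  apply/eqP; rewrite -subr_eq0 -normr_le0; apply/ler_addgt0Pr => e e0; rewrite add0r.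
  have ec0 : 0 < e / c by rewrite divr_gt0.
  have [om [_ om_om0 [z [z' [t [_ _ _ _ [_ <-]]]]]]] := omH _ ec0.
  rewrite -mulmxBl; apply: (le_trans (normr_mulmx_le _ _)); rewrite -/c distrC.
  by rewrite mulrC -ler_pdivlMr//; exact: ltW.
rewrite -(tangent_over_axis om0T om0Q) => e e0.
have e2 : 0 < e / 2 by rewrite divr_gt0.
have [om [_ om_om0 [z [z' [t [Kz Kz' /andP[t0 te] zx [z'z _]]]]]]] := omH _ e2.
exists x1, z', t; split => //; first by rewrite subrr normr0 mul0r.
  by rewrite t0 (lt_le_trans te)// ler_pdivrMr// ler_pMr// ler1n.
have : `|z' - x1 - t *: (w + om0)| <= `|z - x1 - t *: w| + `|t *: (om - om0)|.
  apply: ler_normD_eq; rewrite scalerBr -z'z; row_ring.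
rewrite normrZ (gtr0_norm t0).
have : t * `|om - om0| < t * (e / 2) by rewrite ltr_pM2l.
lra.
Qed.

Let tangent_add c w : secant_cone K 0 x1 w ->
  secant_cone K 0 x1 (w + c *m D).
Proof.
move=> wT; rewrite mulmx_sum_row.
have -> : w + \sum_i c ord0 i *: row i D = \sum_i c ord0 i *: row i D + w by rewrite addrC.
rewrite big_mkcond; elim/big_rec: _ => [|i v _ IH]; first by rewrite add0r.
by rewrite -addrA addrC; exact: tangent_add_axis.
Qed.

Let DQ : D *m Q = 1%:M.
Proof.
apply/row_matrixP => i; rewrite row_mul row1.
have c0 := mx_bound_gt0 Q; set c := mx_bound Q in c0.
apply/esym/eqP; rewrite -subr_eq0 -normr_le0; apply/ler_addgt0Pr => e e0; rewrite add0r.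
have ec0 : 0 < e / c by rewrite divr_gt0.
have [d d0 H] := FD i ec0.
have [d' d'0 H'] := near_b1 i 1.
pose t := Num.min d d' / 2.
have dd : 0 < Num.min d d' by rewrite lt_min d0.
have t0 : 0 < t by rewrite divr_gt0.
have : t < Num.min d d' by rewrite /t; lra.
rewrite lt_min => /andP[td td'].
have [_ _] := FK (H' t ltac:(by rewrite t0)); rewrite mulr1 => fQ.
have td1 : `|t| < d by rewrite gtr0_norm.
have := H t td1; rewrite (gtr0_norm t0) => h.
have : `|(F (b1 + t *: delta_mx ord0 i) - F b1 - t *: row i D) *m Q| <= t * e.
  apply: (le_trans (normr_mulmx_le _ _)); rewrite -/c mulrC -ler_pdivlMr//.
  by apply: (le_trans h); rewrite mulrC mulrA.
rewrite !mulmxBl fQ x1Q -scalemxAl (addrC b1) addrK -scalerBr normrZ (gtr0_norm t0).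
by rewrite ler_pM2l.
Qed.

(** Subtracting [w *m Q *m D] leaves a tangent vector with zero projection, hence zero; conversely,
    all [c *m D] are added to the tangent vector 0. *)
Let tangent_linear w : secant_cone K 0 x1 w <-> exists c, w = c *m D.
Proof.
split=> [wT|[c ->]].
  exists (w *m Q); apply/eqP; rewrite -subr_eq0; apply/eqP.
  apply: (bilipschitz_near_tangent (ltW L0) QL x1x).
    by rewrite -mulNmx; exact: tangent_add.
  by rewrite mulmxBl -(mulmxA (w *m Q)) DQ mulmx1 subrr.
rewrite -[_ *m _]add0r; apply: tangent_add => e e0.
exists x1, x1, (e / 2); split => //.
- by rewrite subrr normr0 mul0r.
- by rewrite divr_gt0//= ltr_pdivrMr// ltr_pMr// ltr1n.
by rewrite subrr scaler0 subr0 normr0 mulr_gt0// divr_gt0.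
Qed.

(** Transport by [A] makes the tangent cone at [F b] a linear space on which [Q] is invertible, with
    inverse [E]. Difference quotients of [F] that deviate from [E] would cluster at a tangent
    vector, which cannot deviate. *)
Lemma graph_mxderiv b : `|b - b0| < rho -> exists E, mxderiv F b E.
Proof.
move=> bb; have [Ky yx yQ] := FK bb; set y := F b in Ky yx yQ.
have [f [A [g [B [fA gB AB BA]]]]] := hom Kx1 Ox1 Ky (rO yx).
have yT w : secant_cone K 0 y w -> exists c, w = c *m (D *m A).
  move=> /(secant_cone_map (lexx 0) gB); rewrite mulr0 => /tangent_linear[c wB].
  by exists c; rewrite mulmxA -wB -mulmxA BA mulmx1.
have Ty c : secant_cone K 0 y (c *m (D *m A)).
  have /tangent_linear/(secant_cone_map (lexx 0) fA) : exists c', c *m D = c' *m D by exists c.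
  by rewrite mulr0 mulmxA.
(* A row killed by this matrix gives a tangent vector with zero projection, so [c *m (D *m A) = 0],
   and [B *m Q] recovers [c] from it. *)
have DAQ : D *m A *m Q \in unitmx.
  rewrite -row_free_unit; apply: inj_row_free => c cDAQ.
  have : c *m (D *m A) = 0.
    apply: (bilipschitz_near_tangent (ltW L0) QL yx (Ty c)).
    by rewrite -mulmxA.
  move=> /(congr1 (mulmx^~ (B *m Q))); rewrite mul0mx !mulmxA.
  by rewrite -(mulmxA _ A) AB mulmx1 -(mulmxA c) DQ mulmx1.
exists (invmx (D *m A *m Q) *m (D *m A)); set E := _ *m _.
have yTE w : secant_cone K 0 y w -> w = w *m Q *m E.
  by move=> /yT[c ->]; rewrite /E -(mulmxA c _ Q) [RHS]mulmxA mulmxK.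
clearbody E.
move=> e e0; apply: contrapT => nF.
pose S eps (om : 'rV[R]_m) := exists z t, [/\ K z, 0 < t < eps,
  z - y = t *: om & e < `|om - om *m Q *m E|].
have [om0 _ omH] : exists2 om0, `|om0 - 0| <= L & forall eps, 0 < eps ->
    exists om, [/\ `|om - 0| <= L, `|om - om0| < eps & S eps om].
  apply: (@compact_approx _ _ [set v : 'rV[R]_m | `|v - 0| <= L] S).
  - exact: closed_ball_rV_compact.
  - move=> e1 e2 om ee [z [t [Kz /andP[t0 te] H]]].
    by exists z, t; split => //; rewrite t0 (lt_le_trans te).
  move=> eps eps0; apply: contrapT => nS; apply: nF.
  exists (Num.min eps (rho - `|b - b0|)); first by rewrite lt_min eps0 subr_gt0.
  move=> b'; rewrite lt_min => /andP[b'e b'r]; rewrite leNgt; apply/negP => H.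
  have b'b : `|b' - b0| < rho.
    have : `|b' - b0| <= `|b' - b| + `|b - b0| by apply: ler_normD_eq; row_ring.
    lra.
  have [Kz zx zQ] := FK b'b.
  have t0 : 0 < `|b' - b|.
    rewrite normr_gt0; apply: contraTneq H => /eqP; rewrite subr_eq0 => /eqP->.
    by rewrite !subrr mul0mx subrr !normr0 mulr0 ltxx.
  apply: nS; exists (`|b' - b|^-1 *: (F b' - y)).
    rewrite /= subr0 normrZ normfV normr_id mulrC ler_pdivrMr//.
    exact: graph_lipschitz.
  exists (F b'), `|b' - b|; split => //; first by rewrite t0.
    by rewrite scalerA divff ?scale1r// gt_eqF.
  rewrite -!scalemxAl -scalerBr normrZ normfV normr_id mulrC ltr_pdivlMr//.
  by rewrite (mulmxBl (F b')) zQ yQ.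
have om0E : om0 = om0 *m Q *m E.
  apply: yTE => eps eps0.
  have [om [_ om_om0 [z [t [Kz /andP[t0 te] zy _]]]]] := omH _ eps0.
  exists y, z, t; split => //; rewrite ?t0// ?subrr ?normr0 ?mul0r//.
  by rewrite zy -scalerBr normrZ (gtr0_norm t0) mulrC ltr_pM2r.
pose a := 1 + mx_bound (Q *m E).
have a0 : 0 < a by rewrite addr_gt0// mx_bound_gt0.
have ea0 : 0 < e / a by rewrite divr_gt0.
have [om [_ om_om0 [z [t [_ _ _ H]]]]] := omH _ ea0.
have : `|om - om *m Q *m E| <= `|om - om0| + `|(om - om0) *m (Q *m E)|.
  rewrite -(normrN (_ *m (Q *m E))) mulmxBl !mulmxA -om0E; apply: ler_normD_eq.
  by rewrite opprB addrA subrK.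
have := normr_mulmx_le (om - om0) (Q *m E).
have : a * `|om - om0| < e by rewrite mulrC -ltr_pdivlMr.
rewrite /a; lra.
Qed.

End PartialDerivativePoint.

(** One point with partial derivatives is enough, as homogeneity reaches the others. It is found
    within [rho / 4] of [b0], so that small increments stay where the clamped extension [G] agrees
    with [F]. *)
Lemma graph_differentiable b : `|b - b0| < rho -> exists E, mxderiv F b E.
Proof.
have r2 : 0 < rho / 2 by rewrite divr_gt0.
have r2' : rho / 2 < rho by rewrite ltr_pdivrMr// ltr_pMr// ltr1n.
pose G := F \o clamp_row b0 (rho / 2).
have clampb b' : `|clamp_row b0 (rho / 2) b' - b0| < rho.
  by apply: le_lt_trans r2'; exact/clamp_row_bound/ltW.
have GL b1 b2 : `|G b1 - G b2| <= L * `|b1 - b2|.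
  apply: (le_trans (graph_lipschitz (clampb b1) (clampb b2))).
  by rewrite ler_pM2l// clamp_row_lipschitz// ltW.
have r4 : 0 < rho / 4 by rewrite divr_gt0.
have [b1 b1b D1] := lipschitz_partial_derivatives b0 (ltW L0) r4 GL.
have /choice[v vH] := D1.
have GF b' : `|b' - b0| <= rho / 2 -> G b' = F b'.
  by move=> b'b; rewrite /G /= clamp_row_id// ltW.
apply: (@graph_mxderiv b1 (\matrix_i v i)); first lra.
move=> i e e0; have /nbhs_ballP[d /= d0 H] := vH i e e0.
exists (Num.min d (rho / 4)); first by rewrite lt_min d0.
move=> t; rewrite lt_min => /andP[td tr].
have := H t; rewrite -ball_normE /= sub0r normrN rowK => /(_ td).
rewrite !GF//; first lra.
have : `|b1 + t *: delta_mx ord0 i - b0| <= `|t *: (delta_mx ord0 i : 'rV[R]_k)| + `|b1 - b0|.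
  by apply: ler_normD_eq; row_ring.
rewrite normrZ normr_delta_row mulr1; lra.
Qed.

End DifferentiableGraph.

(** * Straightening a differentiable graph *)

Section Flattening.
Variables (R : realType) (m k : nat) (K O : set 'rV[R]_m).
Hypotheses (cK : compact K) (oO : open O) (KO : K `&` O !=set0).
Hypothesis hom : locally_homogeneous K O.

(** A straightening of one open piece of [K]; [flat_dom_meets] supplies the point of [K] from which
    homogeneity spreads it. *)
Record flattening := Flattening {
  flat_dom : set 'rV[R]_m ;
  flat_fun : 'rV[R]_m -> 'rV[R]_m ;
  flat_inv : 'rV[R]_m -> 'rV[R]_m ;
  flat_dom_open : open flat_dom ;
  flat_codom_open : open (flat_fun @` flat_dom) ;
  flat_dom_sub : flat_dom `<=` O ;
  flat_dom_meets : K `&` flat_dom !=set0 ;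
  flat_funK : forall z, flat_dom z -> flat_inv (flat_fun z) = z ;
  flat_fun_differentiable : forall z, flat_dom z -> differentiable flat_fun z ;
  flat_inv_differentiable : forall w, (flat_fun @` flat_dom) w ->
    differentiable flat_inv w ;
  flat_image : flat_fun @` (flat_dom `&` K) =
    flat_fun @` flat_dom `&` @coordinate_subspace R m k
}.

End Flattening.

Lemma open_norm_ball (R : realType) n (S : set 'rV[R]_n) :
  (forall z, S z -> exists2 d, 0 < d & forall z', `|z' - z| < d -> S z') ->
  open S.
Proof.
move=> H; rewrite openE => z /H[d d0 dS].
apply/nbhs_ballP; exists d => //= z'; rewrite -ball_normE /= distrC; exact: dS.
Qed.

Section GraphFlattening.
Variables (R : realType) (m k : nat) (K O : set 'rV[R]_m).
Variables (Q : 'M[R]_(m, k)) (x : 'rV[R]_m) (L r : R) (b0 : 'rV[R]_k) (rho : R).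
Hypotheses (QL : bilipschitz_near K Q x L r) (rho0 : 0 < rho).
Hypothesis rO : forall y, `|y - x| < r -> O y.
Variable F : 'rV[R]_k -> 'rV[R]_m.
Hypothesis FK : forall b, `|b - b0| < rho ->
  [/\ K (F b), `|F b - x| < r & F b *m Q = b].
Hypothesis FD : forall b, `|b - b0| < rho -> exists E, mxderiv F b E.

(** Differentiating [F b *m Q = b] gives [Q] a left inverse. *)
Let rankQ : \rank Q = k.
Proof.
have b0b : `|b0 - b0| < rho by rewrite subrr normr0.
have [D FD0] := FD b0b.
have DQ := mxderiv_comp FD0 (mxderiv_mulmx Q _).
have id1 : mxderiv (mulmxr Q \o F) b0 1%:M.
  apply: (mxderiv_eq_near rho0 _ (mxderiv_id b0)) => b bb /=.
  by have [] := FK bb.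
apply/eqP; rewrite -[_ == _]/(row_full Q); apply/row_fullP.
by exists D; exact: mxderiv_unique DQ id1.
Qed.

Let km : (k <= m)%N.
Proof. by rewrite -rankQ rank_leq_row. Qed.

(** Gaussian elimination: in the coordinates [z *m M] the projection [Q] becomes [S], which reads
    only the first [k] coordinates, and [E] embeds R^k into them as a section of [S]. *)
Let M := col_ebase Q.
Let N : 'M[R]_k := row_ebase Q.
Let S : 'M[R]_(m, k) := pid_mx k *m N.
Let E : 'M[R]_(k, m) := invmx N *m pid_mx k.

Let QE : Q = M *m S.
Proof. by rewrite /S mulmxA -{1}(mulmx_ebase Q) rankQ. Qed.

Let ES : E *m S = 1%:M.
Proof.
rewrite /E /S mulmxA -(mulmxA (invmx N)) pid_mx_id// pid_mx_1 mulmx1.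
by rewrite mulVmx// row_ebase_unit.
Qed.

Let MU : M \in unitmx. Proof. exact: col_ebase_unit. Qed.

(** The shear: the residual of [z] over the graph is killed by [S], so it fills the last
    coordinates, while the projection of [z] is placed in the first [k]. [psi] is the inverse. *)
Let phi z := (z - F (z *m Q)) *m M + z *m Q *m E.
Let psi w := F (w *m S) + (w - w *m S *m E) *m invmx M.
Let U := [set z | `|z - x| < r /\ `|z *m Q - b0| < rho].

Let residual_S z : `|z *m Q - b0| < rho -> (z - F (z *m Q)) *m M *m S = 0.
Proof.
by move=> /FK[_ _ FQ]; rewrite -mulmxA -QE mulmxBl FQ subrr.
Qed.

Let phiS z : `|z *m Q - b0| < rho -> phi z *m S = z *m Q.
Proof. by move=> zb; rewrite mulmxDl residual_S// add0r -mulmxA ES mulmx1. Qed.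

Let phiK z : `|z *m Q - b0| < rho -> psi (phi z) = z.
Proof.
by move=> zb; rewrite /psi phiS// /phi addrK mulmxK// addrC subrK.
Qed.

Let psiQ w : `|w *m S - b0| < rho -> psi w *m Q = w *m S.
Proof.
move=> /FK[_ _ FQ]; rewrite mulmxDl FQ [X in _ *m invmx M *m X]QE (mulmxA _ M) mulmxKV// mulmxBl.
by rewrite -(mulmxA _ E) ES mulmx1 subrr addr0.
Qed.

Let psiK w : `|w *m S - b0| < rho -> phi (psi w) = w.
Proof.
move=> wb; rewrite /phi psiQ// /psi (addrC (F _)) addrK.
by rewrite mulmxKV// subrK.
Qed.

Let phi_image w : (phi @` U) w <-> `|w *m S - b0| < rho /\ `|psi w - x| < r.
Proof.
split=> [[z [zx zb] <-]|[wb px]]; first by rewrite phiS// phiK.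
by exists (psi w); [split=> //; rewrite psiQ|exact: psiK].
Qed.

Let near_proj p n (A : 'M[R]_(p, n)) (c b : 'rV[R]_n) (z : 'rV[R]_p) s :
  `|z *m A - c| < s ->
  exists2 d, 0 < d & forall z', `|z' - z| < d -> `|z' *m A - c| < s.
Proof.
move=> zs; have c0 := mx_bound_gt0 A; set q := mx_bound A in c0.
exists ((s - `|z *m A - c|) / q); first by rewrite divr_gt0// subr_gt0.
move=> z'; rewrite ltr_pdivlMr// => z'z.
have : `|z' *m A - c| <= `|(z' - z) *m A| + `|z *m A - c|.
  by apply: ler_normD_eq; rewrite mulmxBl; move: (z' *m A) (z *m A) => u v; row_ring.
have := normr_mulmx_le (z' - z) A; rewrite -/q; lra.
Qed.

Let phi_mxderiv z : `|z *m Q - b0| < rho -> exists A, mxderiv phi z A.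
Proof.
move=> zb; have [D FDz] := FD zb.
have FQz := mxderiv_comp (mxderiv_mulmx Q z) FDz.
have FQM := mxderiv_comp FQz (mxderiv_mulmx (- M) _).
have := mxderivD (mxderivD (mxderiv_mulmx M z) FQM) (mxderiv_mulmx (Q *m E) z).
rewrite (_ : (fun _ => _) = phi); first by eexists; eassumption.
apply/funext => z' /=; rewrite /phi mulmxN -mulmxBl mulmxA.
by [].
Qed.

Let psi_mxderiv w : `|w *m S - b0| < rho -> exists A, mxderiv psi w A.
Proof.
move=> wb; have [D FDw] := FD wb.
have FSw := mxderiv_comp (mxderiv_mulmx S w) FDw.
have := mxderivD FSw (mxderiv_mulmx ((1%:M - S *m E) *m invmx M) w).
rewrite (_ : (fun _ => _) = psi); first by eexists; eassumption.
apply/funext => w' /=; rewrite /psi (mulmxA w' (1%:M - _)) mulmxBr mulmx1 (mulmxA w' S).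
by [].
Qed.

(** The first [k] coordinates of the residual vanish because [S] kills it; in the others [E]
    contributes nothing, so the assumption on [phi z] makes them vanish too. *)
Let phi_coordinate z : `|z *m Q - b0| < rho ->
  @coordinate_subspace R m k (phi z) -> z = F (z *m Q).
Proof.
move=> zb zc; suff : (z - F (z *m Q)) *m M = 0.
  move=> /(congr1 (mulmx^~ (invmx M))); rewrite mulmxK// mul0mx.
  by move=> /eqP; rewrite subr_eq0 => /eqP.
set u := _ *m M.
have uS : u *m pid_mx k = 0 :> 'rV_k.
  have := residual_S zb; rewrite -/u /S mulmxA.
  move=> /(congr1 (mulmx^~ (invmx N))).
  by rewrite mulmxK ?row_ebase_unit// mul0mx.
apply/rowP => i; rewrite [RHS]mxE; have [ki|ik] := leqP k i.
  have := zc i ki; rewrite /phi -/u mxE => <-.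
  rewrite [X in _ = _ + X](_ : _ = 0) ?addr0// /E !mulmxA mxE big1// => j _.
  rewrite [pid_mx k _ _]mxE; case: (j =P i :> nat) => [ji|_]; last by rewrite mulr0.
  by rewrite ji ltnNge ki mulr0.
suff <- : (u *m pid_mx k : 'rV[R]_k) ord0 (Ordinal ik) = u ord0 i by rewrite uS mxE.
rewrite mxE (bigD1 i)//= big1 => [|j ji].
  by rewrite [pid_mx k _ _]mxE eqxx ik mulr1 addr0.
rewrite [pid_mx k _ _]mxE /=; case: (j =P i :> nat) => [jE|_]; last by rewrite mulr0.
by move: ji; rewrite (_ : j = i) ?eqxx//; exact: val_inj.
Qed.

Let phi_graph z : z = F (z *m Q) -> @coordinate_subspace R m k (phi z).
Proof.
move=> zF i ki; rewrite /phi -zF subrr mul0mx add0r /E !mulmxA mxE big1// => j _.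
rewrite [pid_mx k _ _]mxE; case: (j =P i :> nat) => [ji|_]; last by rewrite mulr0.
by rewrite ji ltnNge ki mulr0.
Qed.

Let U_open : open U.
Proof.
apply: open_norm_ball => z [zx zb].
have [d d0 H] := near_proj 0 zb.
exists (Num.min d (r - `|z - x|)); first by rewrite lt_min d0 subr_gt0.
move=> z'; rewrite lt_min => /andP[/H z'b z'z]; split => //.
have : `|z' - x| <= `|z' - z| + `|z - x| by apply: ler_normD_eq; row_ring.
lra.
Qed.

Let phiU_open : open (phi @` U).
Proof.
apply: open_norm_ball => w /phi_image[wb wx].
have [d d0 H] := near_proj 0 wb.
have [A pA] := psi_mxderiv wb.
have rx : 0 < r - `|psi w - x| by rewrite subr_gt0.
have [d' d'0 H'] := mxderiv_near pA rx.
exists (Num.min d d'); first by rewrite lt_min d0.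
move=> w'; rewrite lt_min => /andP[/H w'b /H' w'x]; apply/phi_image; split => //.
have : `|psi w' - x| <= `|psi w' - psi w| + `|psi w - x|.
  by apply: ler_normD_eq; row_ring.
lra.
Qed.

Let phi_imageK : phi @` (U `&` K) = phi @` U `&` @coordinate_subspace R m k.
Proof.
apply/seteqP; split => [_ [z [[zx zb] Kz] <-]|_ [[z [zx zb] <-] zc]].
  split; first by exists z.
  by apply: phi_graph; rewrite (graph_eq QL FK).
have zF := phi_coordinate zb zc.
exists z => //; split => //; rewrite zF.
by have [] := FK zb.
Qed.

Lemma graph_flattening : flattening k K O.
Proof.
apply: (@Flattening _ _ _ _ _ U phi psi).
- exact: U_open.
- exact: phiU_open.
- by move=> z [/rO].
- have b0b : `|b0 - b0| < rho by rewrite subrr normr0.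
  by have [Kb bx bQ] := FK b0b; exists (F b0); split => //; split => //; rewrite bQ.
- by move=> z [_ /phiK].
- by move=> z [_ /phi_mxderiv[A /mxderiv_differentiable]].
- by move=> w /phi_image[/psi_mxderiv[A /mxderiv_differentiable]].
- exact: phi_imageK.
Qed.

End GraphFlattening.

Lemma exists_flattening (R : realType) (m : nat) (K O : set 'rV[R]_m) :
  compact K -> open O -> K `&` O !=set0 -> locally_homogeneous K O ->
  exists k, (k <= m)%N /\ inhabited (flattening k K O).
Proof.
move=> cK oO KO hom.
have [k km [Q [x [L [r [b0 [rho [L0 QL rho0 rO QK]]]]]]]] :=
  exists_lipschitz_graph_over_ball cK oO KO hom.
exists k; split => //.
have /choice[F FK] : forall b, exists y, `|b - b0| < rho ->
    [/\ K y, `|y - x| < r & y *m Q = b].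
  move=> b; have [/QK[y yH]|nb] := pselect (`|b - b0| < rho); first by exists y.
  by exists x.
constructor; apply: (graph_flattening QL rho0 rO FK) => b bb.
exact: (graph_differentiable cK oO KO hom L0 QL rho0 rO FK bb).
Qed.

(** * Transport to the manifold *)

(** A compact neighbourhood in the subspace is pushed into [T] by the inclusion; its image [C] is
    compact and lies in [N]. *)
Lemma locally_compact_subspaceP (T : topologicalType) (N : set T) p :
  locally_compact_subspace N -> N p ->
  exists C V, [/\ compact C, C `<=` N, open V, V p & V `&` N `<=` C].
Proof.
move=> lcN Np; pose a : set_type N := exist _ p (mem_set Np).
have [U] := lcN a Logic.I.
move=> [_ /= [[W oW <-] /= Wp WU]] [cU _].
exists (set_val @` U), W; split => //.
- apply: continuous_compact => //; apply: continuous_subspaceT.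
  exact: initial_continuous.
- by move=> _ [q _ <-]; exact: set_valP.
- move=> q [Wq Nq]; exists (exist _ q (mem_set Nq)) => //.
  exact: (WU (exist _ q (mem_set Nq))).
Qed.

Lemma near_norm_ball (R : realType) n (x : 'rV[R]_n) (P : set 'rV[R]_n) :
  nbhs x P -> exists2 d, 0 < d & forall z, `|z - x| < d -> P z.
Proof.
move=> /nbhs_ballP[d /= d0 dP]; exists d => // z zx; apply: dP.
by rewrite -ball_normE /= distrC.
Qed.

Section Charts.
Variables (R : realType) (m : nat) (M : smooth_manifold R m).
Variable c : chart R m M.
Hypothesis cA : charts (manifold_atlas M) c.

Lemma chart_invK v : (c @` chart_dom c) v -> c (chart_inv c v) = v.
Proof. by move=> [p cp <-]; rewrite chart_funK// mem_set. Qed.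

Lemma chart_inv_dom v : (c @` chart_dom c) v -> chart_dom c (chart_inv c v).
Proof. by move=> [p cp <-]; rewrite chart_funK// mem_set. Qed.

Lemma chart_inv_near v (P : set M) : (c @` chart_dom c) v ->
  nbhs (chart_inv c v) P -> nbhs v (chart_inv c @^-1` P).
Proof. by move=> cv; exact: (chart_inv_continuous (mem_set cv)). Qed.

Lemma chart_near p (P : set 'rV[R]_m) : chart_dom c p ->
  nbhs (c p) P -> nbhs p (c @^-1` P).
Proof. by move=> cp; exact: (chart_fun_continuous (mem_set cp)). Qed.

Section LocalRepresentative.
Variables (N : set M) (v0 : 'rV[R]_m) (s : R).

Definition chart_trace := [set v | `|v - v0| <= s /\ N (chart_inv c v)].

Hypothesis ball_codom : [set v | `|v - v0| <= s] `<=` c @` chart_dom c.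

Lemma local_representative x y (Ux : set M) (h : M -> M) :
  chart_trace x -> `|y - v0| < s ->
  open Ux -> Ux (chart_inv c x) -> h (chart_inv c x) = chart_inv c y ->
  smooth_at (manifold_atlas M) (manifold_atlas M) h (chart_inv c x) ->
  (forall p, Ux p -> N p -> N (h p)) ->
  exists A, local_map chart_trace x y (c \o h \o chart_inv c) A.
Proof.
move=> [xs Nx] ys oU Uxx hx [ch dh] hN.
have cx : (c @` chart_dom c) x by exact: ball_codom.
have cy : (c @` chart_dom c) y by apply: ball_codom; exact: ltW.
have fx : (c \o h \o chart_inv c) x = y by rewrite /= hx chart_invK.
have [A fA] : exists A, mxderiv (c \o h \o chart_inv c) x A.
  apply: differentiable_mxderiv.
  have := dh c c cA cA (chart_inv_dom cx); rewrite chart_invK//; apply.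
  by rewrite hx; exact: chart_inv_dom.
exists A; split => //.
have [d1 d10 H1] := near_norm_ball
  (chart_inv_near cx (open_nbhs_nbhs (conj oU Uxx))).
have hdom : nbhs (h (chart_inv c x)) (chart_dom c).
  apply: open_nbhs_nbhs; split; first exact: chart_dom_open.
  by rewrite hx; exact: chart_inv_dom.
have [d2 d20 H2] := near_norm_ball (chart_inv_near cx (ch _ hdom)).
have sy : 0 < s - `|y - v0| by rewrite subr_gt0.
have [d3 d30 H3] := mxderiv_near fA sy.
(* [d1] keeps [z] in the domain of [h], [d2] its image in the chart, and [d3] the image in the ball,
   in whose interior [y] lies. *)
exists (Num.min d1 (Num.min d2 d3)); first by rewrite !lt_min d10 d20.
move=> z; rewrite !lt_min => /and3P[/H1 z1 /H2 z2 /H3 z3] [zs Nz]; split.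
  rewrite fx in z3; set w := (_ \o _) z in z3 *.
  have : `|w - v0| <= `|w - y| + `|y - v0| by apply: ler_normD_eq; row_ring.
  lra.
by rewrite /= chart_funK ?mem_set//; exact: hN.
Qed.

End LocalRepresentative.

(** Near [x] the two representatives compose to the identity, and derivatives are unique. *)
Lemma representative_inverse x y (Ux : set M) (h g : M -> M) A B :
  (c @` chart_dom c) x -> (c @` chart_dom c) y ->
  open Ux -> Ux (chart_inv c x) -> h (chart_inv c x) = chart_inv c y ->
  {for chart_inv c x, continuous h} -> {in Ux, cancel h g} ->
  mxderiv (c \o h \o chart_inv c) x A ->
  mxderiv (c \o g \o chart_inv c) y B -> A *m B = 1%:M.
Proof.
move=> cx cy oU Uxx hx ch hg fA gB.
have fx : (c \o h \o chart_inv c) x = y by rewrite /= hx chart_invK.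
rewrite -fx in gB.
apply: (mxderiv_unique (mxderiv_comp fA gB)).
have [d1 d10 H1] := near_norm_ball
  (chart_inv_near cx (open_nbhs_nbhs (conj oU Uxx))).
have hdom : nbhs (h (chart_inv c x)) (chart_dom c).
  apply: open_nbhs_nbhs; split; first exact: chart_dom_open.
  by rewrite hx; exact: chart_inv_dom.
have [d2 d20 H2] := near_norm_ball (chart_inv_near cx (ch _ hdom)).
have [d3 d30 H3] := near_norm_ball
  (open_nbhs_nbhs (conj (@chart_codom_open _ _ _ c) cx)).
apply: (@mxderiv_eq_near _ _ _ id _ _ _ (Num.min d1 (Num.min d2 d3))) (mxderiv_id x).
  by rewrite !lt_min d10 d20.
move=> z; rewrite !lt_min => /and3P[/H1 z1 /H2 z2 /H3 z3] /=.
by rewrite chart_funK ?mem_set// hg ?mem_set// chart_invK.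
Qed.

End Charts.

Section MainProof.
Variables (R : realType) (m : nat) (M : smooth_manifold R m) (N : set M).
Hypothesis N_locally_compact : locally_compact_subspace N.
Hypothesis N_homogeneous : forall x y : M, N x -> N y ->
  exists (Ux Uy : set M) (h : M -> M),
    [/\ Ux x, Uy y,
        diffeomorphism (manifold_atlas M) (manifold_atlas M) Ux Uy h,
        h x = y &
        h @` (Ux `&` N) = Uy `&` N].

Variables (c : chart R m M) (p0 : M).
Hypotheses (cA : charts (manifold_atlas M) c) (cp0 : chart_dom c p0) (Np0 : N p0).

(** Near [p0] the set [N] agrees with a compact [C], closed since [M] is Hausdorff. The trace is
    therefore closed in a compact ball. *)
Let exists_trace : exists2 s, 0 < s &
  [set v | `|v - c p0| <= s] `<=` c @` chart_dom c /\
  compact (chart_trace c N (c p0) s).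
Proof.
have [C [V [cC CN oV Vp0 VNC]]] := locally_compact_subspaceP N_locally_compact Np0.
have ccp0 : (c @` chart_dom c) (c p0) by exists p0.
have [d1 d10 H1] := near_norm_ball
  (open_nbhs_nbhs (conj (@chart_codom_open _ _ _ c) ccp0)).
have V0 : nbhs (chart_inv c (c p0)) V.
  by rewrite chart_funK ?mem_set//; exact: open_nbhs_nbhs (conj oV Vp0).
have [d2 d20 H2] := near_norm_ball (chart_inv_near ccp0 V0).
pose d := Num.min d1 d2; have d0 : 0 < d by rewrite lt_min d10.
have d2d : d / 2 < d by rewrite ltr_pdivrMr// ltr_pMr// ltr1n.
have sub v : `|v - c p0| <= d / 2 ->
    (c @` chart_dom c) v /\ V (chart_inv c v).
  move=> vd; have : `|v - c p0| < d by exact: le_lt_trans d2d.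
  by rewrite lt_min => /andP[/H1 ? /H2].
exists (d / 2); first by rewrite divr_gt0.
split; first by move=> v /sub[].
have clC : closed C by apply: compact_closed => //; exact: manifold_hausdorff.
pose D := [set v : 'rV[R]_m | `|v - c p0| <= d / 2].
have cD : compact D by exact: closed_ball_rV_compact.
apply: (subclosed_compact _ cD); last by move=> v [].
have clD : closed D by apply: compact_closed => //; exact: norm_hausdorff.
rewrite -[X in closed X]setCK; apply: open_closedC.
rewrite openE => v /= nv; have [vD|nvD] := pselect (D v); last first.
  apply: (filterS _ (open_nbhs_nbhs (conj (closed_openC clD) nvD))).
  by move=> w nDw [Dw _].
have [cv Vv] := sub v vD.
have nC : (~` C) (chart_inv c v) by move=> /CN Nv; apply: nv.
have := chart_inv_near cv (open_nbhs_nbhs (conj (closed_openC clC) nC)).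
apply: filterS => w nCw [Dw Nw]; apply: nCw; apply: VNC; split => //.
by have [] := sub w Dw.
Qed.

Let trace_homogeneous s : [set v | `|v - c p0| <= s] `<=` c @` chart_dom c ->
  locally_homogeneous (chart_trace c N (c p0) s) [set v | `|v - c p0| < s].
Proof.
move=> sub x y Kx xs Ky ys.
have [[_ Nx] [_ Ny]] := (Kx, Ky).
have [Ux [Uy [h [Uxx Uyy [oUx oUy [hU hI hS] hs [g hg gs]] hx hN]]]] :=
  N_homogeneous Nx Ny.
have gy : g (chart_inv c y) = chart_inv c x by rewrite -hx hg ?mem_set.
have hN' p : Ux p -> N p -> N (h p).
  by move=> Up Np; have [] : (Uy `&` N) (h p) by rewrite -hN; exists p.
have gN' q : Uy q -> N q -> N (g q).
  move=> Uq Nq; have : (Uy `&` N) q by [].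
  by rewrite -hN => -[p [Up Np] <-]; rewrite hg ?mem_set.
have cx : (c @` chart_dom c) x by apply: sub; exact: ltW.
have cy : (c @` chart_dom c) y by apply: sub; exact: ltW.
have [A fA] := local_representative cA sub Kx ys oUx Uxx hx (hs _ Uxx) hN'.
have [B gB] := local_representative cA sub Ky xs oUy Uyy gy (gs _ Uyy) gN'.
have AB : A *m B = 1%:M.
  have [[_ fA' _] [_ gB' _]] := (fA, gB).
  exact: (representative_inverse cx cy oUx Uxx hx (hs _ Uxx).1 hg fA' gB').
exists (c \o h \o chart_inv c), A, (c \o g \o chart_inv c), B; split => //.
exact: mulmx1C.
Qed.

Lemma homogeneous_submanifold : smooth_submanifold N.
Proof.
have [s s0 [sub cK]] := exists_trace.
set K := chart_trace c N (c p0) s in cK; pose O := [set v | `|v - c p0| < s].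
have oO : open O.
  apply: open_norm_ball => z zs; exists (s - `|z - c p0|); first by rewrite subr_gt0.
  move=> z' z'z; have : `|z' - c p0| <= `|z' - z| + `|z - c p0|.
    by apply: ler_normD_eq; row_ring.
  by rewrite /O /=; lra.
have KO : K `&` O !=set0.
  exists (c p0); split; last by rewrite /O /= subrr normr0.
  by split; rewrite ?subrr ?normr0 ?ltW// chart_funK ?mem_set.
have [k [km [[U0 phi psi oU0 oV0 U0O [x0 [Kx0 U0x0]] phiK dphi dpsi img]]]] :=
  exists_flattening cK oO KO (trace_homogeneous sub).
have U0c z : U0 z -> (c @` chart_dom c) z by move=> /U0O/ltW/sub.
exists k => // y Ny.
have Nx0 : N (chart_inv c x0) by have [] := Kx0.
have [Uy [Ux [h [Uyy Uxx [oUy oUx [hU hI hS] hs [g hg gs]] hy hN]]]] :=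
  N_homogeneous Ny Nx0.
(* [h] carries [y] to the point of [M] represented by [x0]; [U] is the part of its domain that lands
   in the flattened piece. *)
pose U := Uy `&` [set p | chart_dom c (h p) /\ U0 (c (h p))].
pose f := phi \o c \o h.
pose fi := g \o chart_inv c \o psi.
have fiK p : U p -> fi (f p) = p.
  move=> [Up [cp U0p]].
  by rewrite /fi /f /= phiK// chart_funK ?mem_set// hg ?mem_set.
have fU w : (f @` U) w <-> (phi @` U0) w /\ Ux (chart_inv c (psi w)).
  split=> [[p [Up [cp U0p]] <-]|[[z U0z <-] Uxz]].
    split; first by exists (c (h p)).
    by rewrite /f /= phiK// chart_funK ?mem_set//; exact: hU.
  rewrite phiK// in Uxz; have [p Up hp] := hS _ Uxz; exists p.
    split => //=; rewrite hp chart_invK//; last exact: U0c.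
    by split => //; apply: chart_inv_dom; exact: U0c.
  by rewrite /f /= hp chart_invK//; exact: U0c.
have psiU0 w : (phi @` U0) w -> U0 (psi w) by move=> [z U0z <-]; rewrite phiK.
have oU : open U.
  rewrite openE => p [Up [cp U0p]].
  have n1 : nbhs p Uy by exact: (open_nbhs_nbhs (conj oUy Up)).
  have n2 : nbhs (h p) (chart_dom c).
    exact: (open_nbhs_nbhs (conj (@chart_dom_open _ _ _ c) cp)).
  have n3 := chart_near cp (open_nbhs_nbhs (conj oU0 U0p)).
  exact: (filterI n1 ((hs _ Up).1 _ (filterI n2 n3))).
have cfi w : (phi @` U0) w -> Ux (chart_inv c (psi w)) ->
    forall P, nbhs (chart_inv c (psi w)) P -> nbhs w ((chart_inv c \o psi) @^-1` P).
  move=> Vw Uxw P nP.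
  exact: (differentiable_continuous (dpsi _ Vw) (chart_inv_near (U0c _ (psiU0 _ Vw)) nP)).
have oV : open (f @` U).
  rewrite openE => w /fU[Vw Uxw].
  have n1 : nbhs w (phi @` U0) by exact: (open_nbhs_nbhs (conj oV0 Vw)).
  have n2 := cfi w Vw Uxw _ (open_nbhs_nbhs (conj oUx Uxw)).
  by apply: filterS2 n1 n2 => w' V' Ux'; apply/fU; split.
exists U, f; split.
- split => //=; rewrite hy; split.
    by apply: chart_inv_dom; exact: U0c.
  by rewrite chart_invK//; exact: U0c.
- split; [exact: oU|exact: oV| | |].
  + split; [by move=> p Up; exists p| |by move=> w].
    move=> p q /set_mem Up /set_mem Uq fpq.
    by rewrite -(fiK p)// fpq fiK.
  + move=> p [Up [cp U0p]]; have [ch dh] := hs _ Up.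
    split.
      move=> P /(differentiable_continuous (dphi _ U0p)) nP.
      exact: (ch _ (chart_near cp nP)).
    move=> d e dA -> dp _ /=.
    have dhd := dh d c dA cA dp cp.
    have E : chart_inv d (d p) = p by rewrite chart_funK ?mem_set.
    apply: (@differentiable_comp _ _ _ _ (c \o h \o chart_inv d) phi _ dhd).
    by rewrite /= E; exact: dphi.
  exists fi; first by move=> p /set_mem; exact: fiK.
  move=> w /fU[Vw Uxw]; have [cg dg] := gs _ Uxw.
  split.
    by move=> P /cg; exact: cfi.
  move=> e d -> dA _ dw /=.
  have U0w := psiU0 _ Vw.
  have dgd := dg c d cA dA (chart_inv_dom (U0c _ U0w)) dw.
  rewrite chart_invK in dgd; last exact: U0c.
  exact: (differentiable_comp (dpsi _ Vw) dgd).
apply/seteqP; split => [_ [p [Up Np] <-]|w [[p Up <-] kw]].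
  split; first by exists p.
  move: Up => [Up [cp U0p]].
  have [Uxp Nhp] : (Ux `&` N) (h p) by rewrite -hN; exists p.
  have : (phi @` (U0 `&` K)) (f p).
    exists (c (h p)) => //; split => //.
    by split; [exact/ltW/U0O|rewrite chart_funK ?mem_set].
  by rewrite img => -[].
exists p => //; split => //; move: Up => [Up [cp U0p]].
have : (phi @` (U0 `&` K)) (f p) by rewrite img; split => //; exists (c (h p)).
move=> [z [U0z [_ Nz]] fz].
have zE : z = c (h p) by rewrite -(phiK z)// fz /f /= phiK.
have Nhp : N (h p) by move: Nz; rewrite zE chart_funK ?mem_set.
have : (Ux `&` N) (h p) by split => //; exact: hU.
(* Membership in [N] is pulled back through [h]: some [q] of [N] has the same image as [p], and [h]
   is injective. *)
rewrite -hN => -[q [Uq Nq] hq].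
suff -> : p = q by [].
by rewrite -(hg p) ?mem_set// -hq hg ?mem_set.
Qed.

End MainProof.

Theorem mainTheorem2 (R : realType) (m : nat) (M : smooth_manifold R m)
    (N : set M)
    (N_locally_compact : locally_compact_subspace N)
    (N_homogeneous : forall x y : M, N x -> N y ->
      exists (Ux Uy : set M) (h : M -> M),
        [/\ Ux x, Uy y,
            diffeomorphism (manifold_atlas M) (manifold_atlas M) Ux Uy h,
            h x = y &
            h @` (Ux `&` N) = Uy `&` N]) :
  smooth_submanifold N.
Proof.
have [[p Np]|N0] := pselect (exists p, N p); last first.
  (* For empty [N] any dimension works; 0 is taken. *)
  by exists 0%N => // x Nx; case: N0; exists x.
have [c cA cp] := charts_cover (manifold_atlas M) p.
exact: (homogeneous_submanifold N_locally_compact N_homogeneous cA cp Np).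
Qed.
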